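(* Let $\phi$ be a hyperbolic automorphism of the unit disk $\mathbb{D}$ and let $\nu\in\mathbb{R}$. Then $C_\phi$ is recurrent on $\mathcal{S}_\nu$ if and only if $\nu<1/2$.
   Context: $\mathbb{D}$ is the open unit disk of $\mathbb{C}$. For $\nu\in\mathbb{R}$, the weighted Dirichlet space $\mathcal{S}_\nu$ is the Hilbert space of analytic functions $f(z)=\sum_{n\ge 0}a_nz^n$ on $\mathbb{D}$ with $\|f\|_\nu^2=\sum_{n\ge0}|a_n|^2(n+1)^{2\nu}<\infty$. For a self-map $\phi$ of $\mathbb{D}$, $C_\phi f=f\circ\phi$; it is known that $C_\phi$ is bounded on every $\mathcal{S}_\nu$ when $\phi$ is a linear fractional self-map of $\mathbb{D}$. A bounded linear operator $T$ on a Hilbert space $\mathcal{H}$ is recurrent if for every non-empty open $U\subset\mathcal{H}$ there is a positive integer $n$ with $T^n(U)\cap U\neq\emptyset$. A linear fractional map ($\phi(z)=\frac{az+b}{cz+d}$, $ad-bc\ne0$) other than the identity with two distinct fixed points in $\hat{\mathbb{C}}=\mathbb{C}\cup\{\infty\}$ is conjugate (by a linear fractional map) to a dilation $z\mapsto\mu z$; it is hyperbolic if $\mu>0$ (with $\mu\neq1$). A hyperbolic automorphism of $\mathbb{D}$ has both fixed points on the unit circle. *)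

(* Defs.v *)
From Stdlib Require Import Reals FinFun.
From Coquelicot Require Import Coquelicot.
Open Scope R_scope.

Definition disk : Type := {z : C | Cmod z < 1}.

Definition disk_val (z : disk) : C := proj1_sig z.
Coercion disk_val : disk >-> C.

(** [None] is the point at infinity. *)
Definition sphere : Type := option C.

Definition mobius (a b c d : C) (w : sphere) : sphere :=
  match w with
  | Some z =>
      if Ceq_dec (c * z + d)%C 0%C then None
      else Some ((a * z + b) / (c * z + d))%C
  | None => if Ceq_dec c 0%C then None else Some (a / c)%C
  end.

Definition linear_fractional (F : sphere -> sphere) : Prop :=
  exists a b c d : C,
    (a * d - b * c)%C <> 0%C /\ forall w, F w = mobius a b c d w.

Definition dilation (mu : C) (w : sphere) : sphere :=
  option_map (fun z => (mu * z)%C) w.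

(** Linear fractional maps are bijections of the sphere, so [s (F w) =
    dilation mu (s w)] says that [F] is the conjugate of a dilation by [s]. *)
Definition hyperbolic (F : sphere -> sphere) : Prop :=
  linear_fractional F /\
  (exists p q : sphere, p <> q /\ F p = p /\ F q = q) /\
  exists (s : sphere -> sphere) (mu : R),
    linear_fractional s /\ 0 < mu /\ mu <> 1 /\
    forall w, s (F w) = dilation (RtoC mu) (s w).

Definition hyperbolic_automorphism (phi : disk -> disk) : Prop :=
  Bijective phi /\
  exists F : sphere -> sphere,
    hyperbolic F /\ forall z : disk, F (Some (z : C)) = Some (phi z : C).

Definition power_expansion (f : disk -> C) (a : nat -> C) : Prop :=
  forall z : disk, is_pseries a (z : C) (f z).

(** Stated as a relation; [r] is determined by [f], because the Taylor
    coefficients of [f] are. *)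
Definition is_norm (nu : R) (f : disk -> C) (r : R) : Prop :=
  exists (a : nat -> C) (s : R),
    power_expansion f a /\
    is_series (fun n : nat => (Cmod (a n))^2 * Rpower (INR n + 1) (2 * nu)) s /\
    r = sqrt s.

Definition dirichlet_space (nu : R) (f : disk -> C) : Prop :=
  exists r : R, is_norm nu f r.

Definition dirichlet_open (nu : R) (U : (disk -> C) -> Prop) : Prop :=
  (forall f, U f -> dirichlet_space nu f) /\
  forall f, U f ->
    exists eps : R, 0 < eps /\
      forall (g : disk -> C) (r : R),
        dirichlet_space nu g ->
        is_norm nu (fun z => (g z - f z)%C) r -> r < eps -> U g.

Definition composition_operator (phi : disk -> disk) (f : disk -> C)
  : disk -> C := fun z => f (phi z).

(** Recurrence on the weighted Dirichlet space of an operator [T] given by a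
    formula on all functions on the disk.  Only the values of [T] on the space
    matter when [T] maps it into itself, as [composition_operator phi] does for
    linear fractional [phi]. *)
Definition recurrent (nu : R) (T : (disk -> C) -> disk -> C) : Prop :=
  forall U : (disk -> C) -> Prop,
    dirichlet_open nu U -> (exists f, U f) ->
    exists n : nat, (0 < n)%nat /\ exists f, U f /\ U (Nat.iter n T f).

(* Main.v *)
Require Import Defs.
From Stdlib Require Import Reals Lra Lia FinFun FunctionalExtensionality.
From Coquelicot Require Import Coquelicot.
Open Scope R_scope.

(** The image [s(D)] of the disk under the conjugating map is a region
    [P |u|^2 + 2 Re (Q u) + R < 0] invariant under a dilation, so [P = R = 0]: it
    is a half-plane, both fixed points [al] (attracting) and [be] (repelling) lie
    on the circle, and [phi^n] multiplies [(z - be) / (al - z)] by [mu^n].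

    If [nu < 1/2], the functions [h] with [h o phi^n -> 0] are dense.  They
    contain [1 / (1 - w z) - 1 / (1 - w al)], whose image is again a constant
    plus a simple pole, with coefficients [O (mu^-n)] and pole at distance of
    order [mu^-n] from the circle, so that its norm is controlled by
    [sum (k + 1)^(2 nu) x^k = o ((1 - x)^-2)].  The same holds for [phi^-1], and
    [h1 + h2 o phi^-n] then recurs.

    If [nu >= 1/2], a function [p] on the disk satisfies the Lipschitz estimate
    [|p u - p v| <= |u - v| ||p|| / (1 - rho^2)] for [|u|, |v| <= rho].  If [f] and
    [f o phi^n] are both within [e] of [z], applying it at [phi^n h], [phi^n 0]
    and at [h], [0] gives, by the Schwarz-Pick identity and as [h -> 0],
    [1 <= 1 - |phi^n 0|^2 + 2 e], while [|phi^n 0| >= (mu - 1) / (mu + 1)]. *)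

(** * Norms *)

Definition weight (nu : R) (k : nat) : R := Rpower (INR k + 1) (2 * nu).

Lemma weight_pos (nu : R) (k : nat) : 0 < weight nu k.
Proof. apply exp_pos. Qed.

Definition energy (nu : R) (a : nat -> C) (N : nat) : R :=
  sum_f_R0 (fun k => Cmod (a k) ^ 2 * weight nu k) N.

(** The strict bound on the norm is encoded through partial sums alone, so that the estimates
    involve neither limits nor square roots; [norm_lt_is_norm] translates back. *)
Definition norm_lt (nu : R) (f : disk -> C) (e : R) : Prop :=
  0 < e /\ exists (a : nat -> C) (S : R),
    power_expansion f a /\ S < e ^ 2 /\ forall N, energy nu a N <= S.

Lemma energy_term_ge0 (nu : R) (a : nat -> C) (k : nat) :
  0 <= Cmod (a k) ^ 2 * weight nu k.
Proof.
  apply Rmult_le_pos; [apply pow2_ge_0 | apply Rlt_le, weight_pos].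
Qed.

Lemma energy_ge0 (nu : R) (a : nat -> C) (N : nat) : 0 <= energy nu a N.
Proof. apply cond_pos_sum; intro; apply energy_term_ge0. Qed.

Lemma Cmod_disk (z : disk) : Cmod z < 1.
Proof. exact (proj2_sig z). Qed.

Lemma is_series_sum_f_R0_le (u : nat -> R) (s : R) (N : nat) :
  (forall k, 0 <= u k) -> is_series u s -> sum_f_R0 u N <= s.
Proof.
  intros Hu Hs.
  rewrite <- sum_n_Reals.
  apply (is_lim_seq_incr_compare (sum_n u) s Hs).
  intro n; rewrite sum_Sn; unfold plus; simpl; specialize (Hu (S n)); lra.
Qed.

Lemma is_series_of_bounded (u : nat -> R) (M : R) :
  (forall k, 0 <= u k) -> (forall N, sum_f_R0 u N <= M) ->
  exists s, is_series u s /\ s <= M.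
Proof.
  intros Hu HM.
  assert (Hex : ex_finite_lim_seq (sum_n u)).
  { apply ex_finite_lim_seq_incr with M.
    - intro n; rewrite sum_Sn; unfold plus; simpl; specialize (Hu (S n)); lra.
    - intro n; rewrite sum_n_Reals; apply HM. }
  destruct Hex as [s Hs]; exists s; split; [exact Hs |].
  apply (is_lim_seq_le (sum_n u) (fun _ => M) s M); trivial.
  - intro n; rewrite sum_n_Reals; apply HM.
  - apply is_lim_seq_const.
Qed.

Lemma norm_lt_is_norm (nu : R) (f : disk -> C) (e : R) :
  norm_lt nu f e <-> exists r, is_norm nu f r /\ r < e.
Proof.
  split.
  - intros (He & a & M & Ha & HM & HN).
    destruct (is_series_of_bounded _ M (energy_term_ge0 nu a) HN) as (s & Hs & HsM).
    exists (sqrt s); split; [exists a, s; auto |].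
    rewrite <- (sqrt_pow2 e) by lra. apply sqrt_lt_1_alt.
    split; [| lra].
    apply Rle_trans with (2 := is_series_sum_f_R0_le _ _ 0 (energy_term_ge0 nu a) Hs).
    apply (energy_ge0 nu a 0).
  - intros (r & (a & s & Ha & Hs & ->) & Hr).
    assert (Hs0 : 0 <= s).
    { apply Rle_trans with (2 := is_series_sum_f_R0_le _ _ 0 (energy_term_ge0 nu a) Hs).
      apply (energy_ge0 nu a 0). }
    pose proof (sqrt_pos s). split; [lra |].
    exists a, s; repeat split; [exact Ha | |].
    + rewrite <- (sqrt_sqrt s Hs0). simpl. nra.
    + intro N; apply is_series_sum_f_R0_le; [apply energy_term_ge0 | exact Hs].
Qed.

Lemma norm_lt_dirichlet_space (nu : R) (f : disk -> C) (e : R) :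
  norm_lt nu f e -> dirichlet_space nu f.
Proof. intro H; apply norm_lt_is_norm in H; destruct H as (r & H & _); exists r; exact H. Qed.

Lemma dirichlet_space_norm_lt (nu : R) (f : disk -> C) :
  dirichlet_space nu f -> exists e, norm_lt nu f e.
Proof.
  intros [r Hr]; exists (r + 1); apply norm_lt_is_norm; exists r; split; [exact Hr | lra].
Qed.

Lemma norm_lt_le (nu : R) (f : disk -> C) (x y : R) :
  x <= y -> norm_lt nu f x -> norm_lt nu f y.
Proof.
  intros Hxy (Hx & a & M & Ha & HM & HN); split; [lra |].
  exists a, M; repeat split; trivial. nra.
Qed.

Lemma norm_lt_ext (nu : R) (f g : disk -> C) (x : R) :
  (forall z, f z = g z) -> norm_lt nu f x -> norm_lt nu g x.
Proof.
  intros Hfg H; replace g with f; [exact H | apply functional_extensionality, Hfg].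
Qed.

Lemma power_expansion_ext (f g : disk -> C) (a b : nat -> C) :
  (forall z, f z = g z) -> (forall k, a k = b k) -> power_expansion f a -> power_expansion g b.
Proof.
  intros Hf Ha H. replace g with f by (apply functional_extensionality, Hf).
  replace b with a by (apply functional_extensionality, Ha). exact H.
Qed.

(** Young's inequality, in the form that makes [norm_lt_plus] the triangle
    inequality: the right side is [(x + y)^2] when [p = x] and [q = y]. *)
Lemma sqr_plus_le (x y p q : R) :
  0 < x -> 0 < y -> (p + q) ^ 2 <= (x + y) / x * p ^ 2 + (x + y) / y * q ^ 2.
Proof.
  intros Hx Hy.
  assert (E : (x + y) / x * p ^ 2 + (x + y) / y * q ^ 2 - (p + q) ^ 2
              = (y * p - x * q) ^ 2 / (x * y)) by (field; lra).
  assert (0 <= (y * p - x * q) ^ 2 / (x * y)); [| lra].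
  apply Rmult_le_pos; [apply pow2_ge_0 |].
  apply Rlt_le, Rinv_0_lt_compat; nra.
Qed.

Lemma pow_n_Cpow (z : C) (k : nat) : pow_n (K := C_AbsRing) z k = (z ^ k)%C.
Proof. induction k as [| k IH]; [reflexivity | simpl; rewrite IH; reflexivity]. Qed.

Lemma power_expansion_series (f : disk -> C) (a : nat -> C) :
  power_expansion f a <->
  forall z : disk, is_series (V := C_NormedModule) (fun k => ((z : C) ^ k * a k)%C) (f z).
Proof.
  split; intros H z; (eapply is_series_ext; [| exact (H z)]); intro k;
    rewrite pow_n_Cpow; reflexivity.
Qed.

Lemma power_expansion_plus (f g : disk -> C) (a b : nat -> C) :
  power_expansion f a -> power_expansion g b ->
  power_expansion (fun z => (f z + g z)%C) (fun k => (a k + b k)%C).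
Proof. intros Hf Hg z; apply (is_pseries_plus (V := C_NormedModule) a b (disk_val z) _ _ (Hf z) (Hg z)). Qed.

Lemma power_expansion_scal (c : C) (f : disk -> C) (a : nat -> C) :
  power_expansion f a -> power_expansion (fun z => (c * f z)%C) (fun k => (c * a k)%C).
Proof.
  intros Hf z. apply (is_pseries_scal (V := C_NormedModule) c a (disk_val z) _); [| exact (Hf z)].
  apply Cmult_comm.
Qed.

Definition shift (a : nat -> C) (k : nat) : C :=
  match k with O => 0%C | S j => a j end.

Lemma power_expansion_shift (f : disk -> C) (a : nat -> C) :
  power_expansion f a -> power_expansion (fun z => ((z : C) * f z)%C) (shift a).
Proof. intros Hf z; exact (is_pseries_incr_1 (V := C_NormedModule) a (disk_val z) _ (Hf z)). Qed.

Lemma norm_lt_plus (nu : R) (f g : disk -> C) (x y : R) :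
  norm_lt nu f x -> norm_lt nu g y -> norm_lt nu (fun z => (f z + g z)%C) (x + y).
Proof.
  intros (Hx & a & M & Ha & HM & HaN) (Hy & b & M' & Hb & HM' & HbN).
  split; [lra |].
  exists (fun k => (a k + b k)%C), ((x + y) / x * M + (x + y) / y * M').
  assert (Hcx : 0 < (x + y) / x) by (apply Rdiv_lt_0_compat; lra).
  assert (Hcy : 0 < (x + y) / y) by (apply Rdiv_lt_0_compat; lra).
  split; [apply power_expansion_plus; assumption | split].
  - replace ((x + y) ^ 2) with ((x + y) / x * x ^ 2 + (x + y) / y * y ^ 2) by (field; lra).
    apply Rplus_lt_compat; apply Rmult_lt_compat_l; trivial.
  - intro N.
    apply Rle_trans with ((x + y) / x * energy nu a N + (x + y) / y * energy nu b N).
    + unfold energy. rewrite 2!scal_sum, <- plus_sum. apply sum_Rle; intros k _.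
      pose proof (Cmod_triangle (a k) (b k)). pose proof (Cmod_ge_0 (a k + b k)).
      pose proof (sqr_plus_le x y (Cmod (a k)) (Cmod (b k)) Hx Hy).
      pose proof (weight_pos nu k).
      assert (Cmod (a k + b k) ^ 2 <= (Cmod (a k) + Cmod (b k)) ^ 2) by (apply pow_incr; lra).
      apply Rle_trans with (((x + y) / x * Cmod (a k) ^ 2 + (x + y) / y * Cmod (b k) ^ 2) * weight nu k).
      * apply Rmult_le_compat_r; lra.
      * right; ring.
    + apply Rplus_le_compat; apply Rmult_le_compat_l; auto; lra.
Qed.

(** The bound [y] is free because [Cmod c * x] vanishes for [c = 0], while [norm_lt] asks for a
    positive bound. *)
Lemma norm_lt_scal (nu : R) (c : C) (f : disk -> C) (x y : R) :
  norm_lt nu f x -> 0 < y -> Cmod c * x <= y -> norm_lt nu (fun z => (c * f z)%C) y.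
Proof.
  intros (Hx & a & M & Ha & HM & HN) Hy Hc.
  pose proof (Cmod_ge_0 c).
  assert (HM0 : 0 <= M) by (eapply Rle_trans; [apply (energy_ge0 nu a 0) | apply HN]).
  split; [lra |]. exists (fun k => (c * a k)%C), (Cmod c ^ 2 * M).
  split; [apply power_expansion_scal, Ha | split].
  - destruct (Req_dec (Cmod c) 0) as [E | E].
    + rewrite E. simpl. nra.
    + apply Rlt_le_trans with (Cmod c ^ 2 * x ^ 2).
      * apply Rmult_lt_compat_l; [apply pow_lt; lra | exact HM].
      * rewrite <- Rpow_mult_distr. apply pow_incr; split; [nra | lra].
  - intro N. apply Rle_trans with (Cmod c ^ 2 * energy nu a N).
    + unfold energy. rewrite scal_sum. right; apply sum_eq; intros k _.
      rewrite Cmod_mult; ring.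
    + apply Rmult_le_compat_l; [apply pow2_ge_0 | apply HN].
Qed.

Lemma norm_lt_opp (nu : R) (f g : disk -> C) (x : R) :
  norm_lt nu (fun z => (f z - g z)%C) x -> norm_lt nu (fun z => (g z - f z)%C) x.
Proof.
  intro H. apply norm_lt_ext with (fun z => (- (1) * (f z - g z))%C); [intro; ring |].
  apply norm_lt_scal with x; [exact H | apply H |]. rewrite Cmod_m1; lra.
Qed.

Lemma norm_lt_minus_trans (nu : R) (f g h : disk -> C) (x y : R) :
  norm_lt nu (fun z => (f z - g z)%C) x -> norm_lt nu (fun z => (g z - h z)%C) y ->
  norm_lt nu (fun z => (f z - h z)%C) (x + y).
Proof.
  intros H1 H2. eapply norm_lt_ext; [| exact (norm_lt_plus _ _ _ _ _ H1 H2)].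
  intro z; simpl; ring.
Qed.

Definition single (c : C) (k : nat) : C := match k with O => c | S _ => 0%C end.

Lemma power_expansion_const (c : C) : power_expansion (fun _ => c) (single c).
Proof.
  rewrite power_expansion_series; intro z.
  apply is_series_decr_1.
  replace (plus c _) with (RtoC 0)
    by (change (RtoC 0 = c + - (1 * c))%C; ring).
  apply filterlim_ext with (fun _ : nat => RtoC 0); [| apply filterlim_const].
  intro n; induction n as [| n IH].
  - rewrite sum_O. simpl. ring.
  - rewrite sum_Sn, <- IH. change (RtoC 0 = 0 + disk_val z ^ S (S n) * 0)%C. ring.
Qed.

Lemma norm_lt_const (nu : R) (c : C) (e : R) : Cmod c < e -> norm_lt nu (fun _ => c) e.
Proof.
  intro Hc. pose proof (Cmod_ge_0 c). split; [lra |].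
  exists (single c), (Cmod c ^ 2). repeat split; [apply power_expansion_const | nra |].
  intro N. right. unfold energy. induction N as [| N IH].
  - simpl. unfold weight. simpl. rewrite Rplus_0_l. unfold Rpower. rewrite ln_1, Rmult_0_r, exp_0. ring.
  - rewrite tech5, IH. unfold single. rewrite Cmod_0. ring.
Qed.

Lemma norm_lt_0 (nu : R) (f : disk -> C) (e : R) : 0 < e -> (forall z, f z = 0%C) -> norm_lt nu f e.
Proof.
  intros He Hf. apply norm_lt_ext with (fun _ => RtoC 0); [intro; symmetry; apply Hf |].
  apply norm_lt_const. rewrite Cmod_0; exact He.
Qed.

(** The ratio (k + 2) / (k + 1) lies between 1 and 2, and |nu| covers both signs of the exponent.
    Hence multiplication by z is bounded ([norm_lt_shift]). *)
Lemma weight_S_le (nu : R) (k : nat) :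
  weight nu (S k) <= Rpower 2 (2 * Rabs nu) * weight nu k.
Proof.
  unfold weight. rewrite S_INR. pose proof (pos_INR k).
  set (x := INR k + 1). assert (1 <= x) by (unfold x; lra).
  unfold Rpower. rewrite <- exp_plus.
  assert (Hl : 0 <= ln (x + 1) - ln x <= ln 2).
  { assert (ln x < ln (x + 1)) by (apply ln_increasing; lra).
    assert (ln (x + 1) <= ln (2 * x)) by (apply ln_le; lra).
    rewrite ln_mult in H2 by lra. lra. }
  assert (2 * nu * ln (x + 1) <= 2 * Rabs nu * ln 2 + 2 * nu * ln x) as [Hlt | ->].
  { pose proof (Rabs_pos nu). pose proof (RRle_abs nu). nra. }
  - left. apply exp_increasing, Hlt.
  - right; reflexivity.
Qed.

Lemma norm_lt_shift (nu : R) (f : disk -> C) (x : R) :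
  norm_lt nu f x -> norm_lt nu (fun z => ((z : C) * f z)%C) (Rpower 2 (Rabs nu) * x).
Proof.
  intros (Hx & a & M & Ha & HM & HN).
  assert (Hc : 0 < Rpower 2 (Rabs nu)) by apply exp_pos.
  assert (Hc2 : Rpower 2 (2 * Rabs nu) = Rpower 2 (Rabs nu) ^ 2).
  { rewrite <- Rpower_pow by assumption. rewrite Rpower_mult. f_equal. simpl; ring. }
  split; [nra |].
  exists (shift a), (Rpower 2 (2 * Rabs nu) * M).
  split; [apply power_expansion_shift, Ha | split].
  - rewrite Hc2, Rpow_mult_distr. apply Rmult_lt_compat_l; [apply pow_lt |]; assumption.
  - assert (HM0 : 0 <= M) by (eapply Rle_trans; [apply (energy_ge0 nu a 0) | apply HN]).
    assert (Hstep : forall N, energy nu (shift a) (S N) <= Rpower 2 (2 * Rabs nu) * energy nu a N).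
    { assert (Hk : forall k, Cmod (a k) ^ 2 * weight nu (S k)
        <= Rpower 2 (2 * Rabs nu) * (Cmod (a k) ^ 2 * weight nu k)).
      { intro k. pose proof (weight_S_le nu k). pose proof (pow2_ge_0 (Cmod (a k))). nra. }
      unfold energy. induction N as [| N IH].
      - rewrite tech5. cbn [sum_f_R0]. simpl shift. rewrite Cmod_0.
        specialize (Hk 0%nat). lra.
      - rewrite tech5, (tech5 (fun k => Cmod (a k) ^ 2 * _ k)). simpl shift. specialize (Hk (S N)). lra. }
    intros [| N].
    + unfold energy; simpl. rewrite Cmod_0, 2!Rmult_0_l.
      apply Rmult_le_pos; [apply Rlt_le, exp_pos | exact HM0].
    + eapply Rle_trans; [apply Hstep |]. apply Rmult_le_compat_l; [| apply HN].
      apply Rlt_le, exp_pos.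
Qed.

Lemma norm_lt_id (nu : R) : exists e, norm_lt nu (fun z => z) e.
Proof.
  eexists. eapply norm_lt_ext; [| apply norm_lt_shift, (norm_lt_const nu 1 2)].
  - intro z; simpl; ring.
  - rewrite Cmod_1; lra.
Qed.

(** * Lipschitz estimate *)

(** This is the derivative of the geometric series: the partial sums times (1 - x)^2 have a closed
    form, checked by induction. The factor [INR 0] kills the term with [pred 0]. *)
Lemma sum_f_R0_deriv_geom (x : R) (N : nat) :
  0 <= x < 1 -> sum_f_R0 (fun k => INR k * x ^ pred k) N <= / (1 - x) ^ 2.
Proof.
  intro Hx.
  assert (E : sum_f_R0 (fun k => INR k * x ^ pred k) N * (1 - x) ^ 2
              = 1 - (1 + INR N * (1 - x)) * x ^ N).
  { induction N as [| N IH]; [simpl; ring |].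
    rewrite tech5, Rmult_plus_distr_r, IH, S_INR. simpl. ring. }
  assert (0 < (1 - x) ^ 2) by (apply pow_lt; lra).
  apply Rmult_le_reg_r with ((1 - x) ^ 2); [assumption |].
  rewrite E, Rinv_l by lra.
  assert (0 <= (1 + INR N * (1 - x)) * x ^ N); [| lra].
  apply Rmult_le_pos; [pose proof (pos_INR N); nra | apply pow_le; lra].
Qed.

Lemma Cmod_is_series_le (u : nat -> C) (l : C) (B : R) :
  is_series (V := C_NormedModule) u l ->
  (forall N, sum_f_R0 (fun k => Cmod (u k)) N <= B) -> Cmod l <= B.
Proof.
  intros Hl HB.
  assert (Hlim : is_lim_seq (fun n => Cmod (sum_n (u : nat -> C_NormedModule) n)) (Cmod l)).
  { apply (filterlim_comp _ _ _ _ _ _ _ _ Hl (filterlim_norm (V := C_NormedModule) l)). }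
  apply (is_lim_seq_le _ (fun _ => B) (Cmod l) B) with (2 := Hlim); [| apply is_lim_seq_const].
  intro n; apply Rle_trans with (2 := HB n).
  induction n as [| n IH]; [rewrite sum_O; simpl; lra |].
  rewrite sum_Sn, tech5.
  eapply Rle_trans; [apply Cmod_triangle |]. apply Rplus_le_compat_r, IH.
Qed.

Lemma Cmod_Cpow_minus_le (u v : C) (rho : R) (k : nat) :
  Cmod u <= rho -> Cmod v <= rho ->
  Cmod (u ^ k - v ^ k)%C <= Cmod (u - v)%C * (INR k * rho ^ pred k).
Proof.
  intros Hu Hv. pose proof (Cmod_ge_0 u). pose proof (Cmod_ge_0 v).
  induction k as [| k IH].
  - replace (u ^ 0 - v ^ 0)%C with (RtoC 0) by (unfold Cpow; ring). rewrite Cmod_0; simpl; lra.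
  - rewrite 2!Cpow_S.
    replace (u * u ^ k - v * v ^ k)%C
      with (u * (u ^ k - v ^ k) + (u - v) * v ^ k)%C by ring.
    eapply Rle_trans; [apply Cmod_triangle |]. rewrite 2!Cmod_mult, Cmod_pow.
    replace (Cmod (u - v) * (INR (S k) * rho ^ pred (S k)))
      with (rho * (Cmod (u - v) * (INR k * rho ^ pred k)) + Cmod (u - v) * rho ^ k).
    + apply Rplus_le_compat.
      * apply Rmult_le_compat; auto using Cmod_ge_0.
      * apply Rmult_le_compat_l; [apply Cmod_ge_0 | apply pow_incr; lra].
    + rewrite S_INR. destruct k; simpl; ring.
Qed.

(** This is where nu >= 1/2 enters: the norm then dominates the Dirichlet seminorm, whose square is
    the sum of k |a_k|^2. *)
Lemma INR_le_weight (nu : R) (k : nat) : 1 / 2 <= nu -> INR k <= weight nu k.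
Proof.
  intro Hnu. pose proof (pos_INR k).
  apply Rle_trans with (Rpower (INR k + 1) 1); [rewrite Rpower_1; lra |].
  apply Rle_Rpower; lra.
Qed.

(** Bounding |u^k - v^k| by |u - v| k rho^(k-1), Cauchy-Schwarz splits the sum of k |a_k| rho^(k-1)
    into the sum of k |a_k|^2, below e^2, and the sum of k rho^(2(k-1)), at most (1 - rho^2)^-2. *)
Lemma norm_lt_lipschitz (nu : R) (p : disk -> C) (e rho : R) (u v : disk) :
  1 / 2 <= nu -> norm_lt nu p e -> Cmod u <= rho -> Cmod v <= rho -> rho < 1 ->
  Cmod (p u - p v)%C <= Cmod (u - v)%C * (e / (1 - rho ^ 2)).
Proof.
  intros Hnu (He & a & M & Ha & HM & HN) Hu Hv Hrho.
  pose proof (Cmod_ge_0 u).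
  assert (Hr : 0 < 1 - rho ^ 2) by nra.
  apply Cmod_is_series_le with (u := fun k => ((u ^ k - v ^ k) * a k)%C).
  { rewrite power_expansion_series in Ha.
    eapply is_series_ext; [| exact (is_series_minus _ _ _ _ (Ha u) (Ha v))].
    intro k. change (u ^ k * a k - v ^ k * a k = (u ^ k - v ^ k) * a k)%C. ring. }
  intro N. set (t := / (e * (1 - rho ^ 2))).
  assert (Ht : 0 < t) by (apply Rinv_0_lt_compat, Rmult_lt_0_compat; lra).
  (* Cauchy-Schwarz, through [2 A B <= t A^2 + B^2 / t] with the optimal [t] *)
  apply Rle_trans with (sum_f_R0 (fun k => Cmod (u - v)%C * / 2 *
     (t * (Cmod (a k) ^ 2 * weight nu k) + / t * (INR k * (rho ^ 2) ^ pred k))) N).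
  - apply sum_Rle; intros k _. rewrite Cmod_mult.
    pose proof (Cmod_Cpow_minus_le u v rho k Hu Hv) as Hk.
    pose proof (Cmod_ge_0 (a k)). pose proof (Cmod_ge_0 (u - v)). pose proof (pos_INR k).
    apply Rle_trans with (Cmod (u - v) * (INR k * rho ^ pred k) * Cmod (a k)).
    { apply Rmult_le_compat_r; assumption. }
    rewrite 2!(Rmult_assoc (Cmod (u - v))).
    apply Rmult_le_compat_l; [assumption |].
    rewrite <- pow_mult, Nat.mul_comm, pow_mult.
    set (y := rho ^ pred k). set (x := Cmod (a k)) in *.
    assert (Hw : t * (x ^ 2 * INR k) <= t * (x ^ 2 * weight nu k)).
    { apply Rmult_le_compat_l; [lra |].
      apply Rmult_le_compat_l; [apply pow2_ge_0 | apply INR_le_weight, Hnu]. }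
    assert (Hsq : 0 <= INR k * (/ t * (t * x - y) ^ 2)).
    { apply Rmult_le_pos; [assumption |].
      apply Rmult_le_pos; [apply Rlt_le, Rinv_0_lt_compat, Ht | apply pow2_ge_0]. }
    replace (INR k * (/ t * (t * x - y) ^ 2))
      with (t * (x ^ 2 * INR k) - 2 * (INR k * (y * x)) + / t * (INR k * y ^ 2)) in Hsq
      by (field; lra).
    lra.
  - rewrite <- (sum_eq (fun k => (t * (Cmod (a k) ^ 2 * weight nu k)
        + / t * (INR k * (rho ^ 2) ^ pred k)) * (Cmod (u - v) * / 2))) by (intros; ring).
    rewrite <- scal_sum.
    rewrite Rmult_assoc. apply Rmult_le_compat_l; [apply Cmod_ge_0 |].
    rewrite plus_sum.
    rewrite (sum_eq _ (fun k => Cmod (a k) ^ 2 * weight nu k * t)) by (intros; ring).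
    rewrite (sum_eq (fun k => / t * _) (fun k => INR k * (rho ^ 2) ^ pred k * / t)) by (intros; ring).
    rewrite <- 2!scal_sum.
    assert (H1 : t * energy nu a N <= t * e ^ 2).
    { apply Rmult_le_compat_l; [lra |]. specialize (HN N); lra. }
    assert (H2 : / t * sum_f_R0 (fun k => INR k * (rho ^ 2) ^ pred k) N
                 <= / t * / (1 - rho ^ 2) ^ 2).
    { apply Rmult_le_compat_l; [apply Rlt_le, Rinv_0_lt_compat, Ht |].
      apply sum_f_R0_deriv_geom. split; [apply pow2_ge_0 | lra]. }
    unfold energy in H1.
    replace (e / (1 - rho ^ 2)) with (/ 2 * (t * e ^ 2 + / t * / (1 - rho ^ 2) ^ 2))
      by (unfold t; field; lra).
    lra.
Qed.

(** * Geometry of hyperbolic automorphisms *)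

(** [w] is the image of [z] under the hyperbolic map with fixed points [be]
    (repelling) and [al] (attracting) and multiplier [m]: the coordinate
    [(z - be) / (al - z)] is multiplied by [m]. *)
Definition dilates (al be : C) (m : R) (z w : C) : Prop :=
  ((w - be) * (al - z) = m * (z - be) * (al - w))%C.

(** The denominator of w as a linear fractional function of z, obtained by solving [dilates] for
    w. *)
Definition den (al be : C) (m : R) (z : C) : C := (al - z + m * (z - be))%C.

Lemma unit_neq0 (z : C) : Cmod z = 1 -> z <> 0%C.
Proof. intros H E. rewrite E, Cmod_0 in H; lra. Qed.

Lemma unit_conj (z : C) : Cmod z = 1 -> Cconj z = (/ z)%C.
Proof.
  intro H. pose proof (unit_neq0 z H).
  pose proof (Cmod2_conj z) as E. rewrite H in E.
  assert (E' : (z * Cconj z = 1)%C).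
  { rewrite <- E. f_equal. ring. }
  replace (Cconj z) with ((z * Cconj z) / z)%C by (field; assumption).
  rewrite E'. field; assumption.
Qed.

Lemma Cconj_R (x : R) : Cconj x = x.
Proof. apply injective_projections; simpl; ring. Qed.

Section Geometry.
Variables (al be : C) (m : R).
Hypotheses (Hal : Cmod al = 1) (Hbe : Cmod be = 1) (Hm : 1 < m).

Lemma dilates_den (z w : C) : dilates al be m z w ->
  (w * den al be m z = m * al * (z - be) + be * (al - z))%C.
Proof.
  intro H; unfold dilates, den in *.
  replace (w * (al - z + m * (z - be)))%C
    with ((w - be) * (al - z) + be * (al - z) - m * (z - be) * (al - w) + m * al * (z - be))%C by ring.
  rewrite H. ring.
Qed.

Lemma den0_ge : m - 1 <= Cmod (den al be m 0).
Proof.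
  pose proof (Cmod_triangle (den al be m 0) (- al)) as H.
  replace (den al be m 0 + - al)%C with (- (m * be))%C in H by (unfold den; ring).
  rewrite 2!Cmod_opp, Cmod_mult, Cmod_R, Hal, Hbe, Rabs_right in H by lra. lra.
Qed.

Lemma den0_le : Cmod (den al be m 0) <= m + 1.
Proof.
  pose proof (Cmod_triangle al (- (m * be))) as H.
  replace (den al be m 0) with (al + - (m * be))%C by (unfold den; ring).
  rewrite Cmod_opp, Cmod_mult, Cmod_R, Hal, Hbe, Rabs_right in H by lra. lra.
Qed.

(** [den] is affine in z with slope m - 1, which is at most its modulus at 0 by [den0_ge]. *)
Lemma den_bounds (z : C) :
  Cmod (den al be m 0) * (1 - Cmod z) <= Cmod (den al be m z)
    <= Cmod (den al be m 0) * (1 + Cmod z).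
Proof.
  pose proof den0_ge as H0. pose proof (Cmod_ge_0 z).
  pose proof (Cmod_triangle (den al be m 0) (RtoC (m - 1) * z)) as H1.
  pose proof (Cmod_triangle (den al be m z) (- (RtoC (m - 1) * z))) as H2.
  replace (den al be m 0 + RtoC (m - 1) * z)%C with (den al be m z) in H1
    by (unfold den; rewrite RtoC_minus; ring).
  replace (den al be m z + - (RtoC (m - 1) * z))%C with (den al be m 0) in H2
    by (unfold den; rewrite RtoC_minus; ring).
  rewrite ?Cmod_opp, Cmod_mult, Cmod_R, Rabs_right in H1 by lra.
  rewrite ?Cmod_opp, Cmod_mult, Cmod_R, Rabs_right in H2 by lra.
  nra.
Qed.

Lemma den_pos (z : C) : Cmod z < 1 -> 0 < Cmod (den al be m z).
Proof. intro Hz. pose proof (den_bounds z). pose proof den0_ge. nra. Qed.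

(** The Schwarz-Pick identity for a disk automorphism. With squared moduli written as products with
    conjugates, and the conjugates of [al] and [be] replaced by inverses, it becomes a rational
    identity. *)
Lemma dilates_pick (z w : C) : dilates al be m z w ->
  Cmod (den al be m z) ^ 2 * (1 - Cmod w ^ 2) = m * Cmod (al - be)%C ^ 2 * (1 - Cmod z ^ 2).
Proof.
  intro H. pose proof (dilates_den z w H) as E.
  replace (Cmod (den al be m z) ^ 2 * (1 - Cmod w ^ 2))
    with (Cmod (den al be m z) ^ 2 - Cmod (w * den al be m z)%C ^ 2)
    by (rewrite Cmod_mult; ring).
  rewrite E. apply RtoC_inj. unfold den.
  rewrite ?RtoC_minus, ?RtoC_mult, ?RtoC_minus, !Cmod2_conj.
  rewrite ?Cplus_conj, ?Cmult_conj, ?Cminus_conj, ?Cmult_conj, ?Cminus_conj, ?Cconj_R.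
  rewrite (unit_conj al Hal), (unit_conj be Hbe).
  field. split; apply unit_neq0; assumption.
Qed.

(** A linear fractional map F with determinant D and denominator q satisfies F u - F v = D (u - v) /
    (q(u) q(v)); here D = m (al - be)^2. *)
Lemma dilates_minus (u v u' v' : C) : Cmod u < 1 -> Cmod v < 1 ->
  dilates al be m u u' -> dilates al be m v v' ->
  Cmod (u' - v')%C * Cmod (den al be m u) * Cmod (den al be m v)
  = m * Cmod (al - be)%C ^ 2 * Cmod (u - v)%C.
Proof.
  intros Hu Hv E1 E2. apply dilates_den in E1, E2.
  rewrite <- !Cmod_mult.
  replace ((u' - v') * den al be m u * den al be m v)%C
    with (m * ((al - be) * (al - be)) * (u - v))%C.
  - rewrite !Cmod_mult, Cmod_R, Rabs_right by lra. ring.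
  - replace ((u' - v') * den al be m u * den al be m v)%C
      with (u' * den al be m u * den al be m v - v' * den al be m v * den al be m u)%C by ring.
    rewrite E1, E2. unfold den. ring.
Qed.

Lemma dilates_0_ge (w : C) : dilates al be m 0 w -> (m - 1) / (m + 1) <= Cmod w.
Proof.
  intro E. apply dilates_den in E. apply (f_equal Cmod) in E.
  replace (m * al * (0 - be) + be * (al - 0))%C with (- ((m - 1)%R * (al * be)))%C in E
    by (rewrite RtoC_minus; ring).
  rewrite Cmod_opp, !Cmod_mult, Cmod_R, Hal, Hbe, Rabs_right in E by lra.
  pose proof den0_le. pose proof (Cmod_ge_0 w).
  apply Rmult_le_reg_r with (m + 1); [lra |].
  unfold Rdiv. rewrite Rmult_assoc, Rinv_l by lra. nra.
Qed.

End Geometry.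

Lemma dilates_iter (al be : C) (mu : R) (phi : disk -> disk) :
  Cmod al = 1 -> (forall z : disk, dilates al be mu z (phi z)) ->
  forall n (z : disk), dilates al be (mu ^ n) z (Nat.iter n phi z).
Proof.
  intros Hal Hphi n z. induction n as [| n IH]; [unfold dilates; simpl; ring |].
  simpl Nat.iter. set (y := Nat.iter n phi z) in *. specialize (Hphi y).
  unfold dilates in *.
  (* [al] lies on the circle and y inside the disk, so this factor may be cancelled when two
     relations are composed. *)
  assert (Hne : (al - y)%C <> 0%C).
  { intro E. apply (f_equal (fun c => Cmod (c + y))) in E.
    replace (al - y + y)%C with al in E by ring. rewrite Hal, Cplus_0_l in E.
    destruct y as [y Hy]; simpl in E. lra. }
  rewrite <- tech_pow_Rmult, RtoC_mult.
  transitivity ((phi y - be) * (al - y) * (al - z) / (al - y))%C; [field; exact Hne |].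
  rewrite Hphi.
  transitivity (mu * (al - phi y) * ((y - be) * (al - z)) / (al - y))%C; [field; exact Hne |].
  rewrite IH. field; exact Hne.
Qed.

(** * Normal form of hyperbolic automorphisms *)

Lemma quadratic_lead_nonpos (A B D : R) :
  (forall M, exists t, M < t /\ A * t ^ 2 + B * t + D <= 0) -> A <= 0.
Proof.
  intro H. apply Rnot_lt_le; intro HA.
  (* Beyond this threshold t > 1 and A t^2 > (|B| + |D|) t, so the quadratic would be positive. *)
  destruct (H (1 + (Rabs B + Rabs D) / A)) as (t & Ht & Hq).
  assert (HBD : 0 <= (Rabs B + Rabs D) / A).
  { apply Rdiv_le_0_compat; [| assumption].
    pose proof (Rabs_pos B); pose proof (Rabs_pos D); lra. }
  assert (Rabs B + Rabs D < A * t).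
  { apply Rmult_lt_reg_l with (/ A); [apply Rinv_0_lt_compat, HA |].
    rewrite <- Rmult_assoc, Rinv_l by lra. unfold Rdiv in *. lra. }
  pose proof (Rle_abs (- B)). pose proof (Rle_abs (- D)). rewrite Rabs_Ropp in *.
  pose proof (Rabs_pos D). assert (1 < t) by lra.
  assert ((Rabs B + Rabs D) * t < A * t * t) by (apply Rmult_lt_compat_r; lra).
  assert (- B * t <= Rabs B * t) by (apply Rmult_le_compat_r; lra).
  assert (Rabs D * 1 <= Rabs D * t) by (apply Rmult_le_compat_l; lra).
  lra.
Qed.

Lemma pow_unbounded (k M : R) : 1 < k -> exists n : nat, M < k ^ n.
Proof.
  intro Hk. destruct (Pow_x_infinity k ltac:(rewrite Rabs_right; lra) (M + 1)) as [n Hn].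
  exists n. specialize (Hn n (le_n n)). rewrite Rabs_right in Hn; [lra |].
  apply Rle_ge, pow_le; lra.
Qed.

Section NormalForm.
Variables a b c d : C.
Hypothesis Hdet : (a * d - b * c)%C <> 0%C.

(** The image of the disk under [z |-> (a z + b) / (c z + d)], away from
    infinity. *)
Definition disk_image (u : C) : Prop := Cmod (d * u - b)%C < Cmod (a - c * u)%C.

(** The relation s (psi z) = k s z for s z = (a z + b) / (c z + d), cross-multiplied so as to make
    sense at a pole of s. *)
Definition semiconjugates (k : R) (psi : disk -> disk) : Prop :=
  forall z : disk, ((a * psi z + b) * (c * z + d) = k * (a * z + b) * (c * psi z + d))%C.

(** If u = s z with z in the disk, then k u = s (psi z), and psi z is again in the disk. *)
Lemma disk_image_scale (k : R) (psi : disk -> disk) (u : C) :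
  semiconjugates k psi -> disk_image u -> disk_image (k * u).
Proof.
  unfold disk_image. intros Hpsi Hu.
  assert (Ha : (a - c * u)%C <> 0%C).
  { intro E. rewrite E, Cmod_0 in Hu. pose proof (Cmod_ge_0 (d * u - b)); lra. }
  assert (Hz : Cmod ((d * u - b) / (a - c * u))%C < 1).
  { rewrite Cmod_div by assumption. apply Cmod_gt_0 in Ha.
    apply Rmult_lt_reg_r with (Cmod (a - c * u)); [assumption |].
    unfold Rdiv; rewrite Rmult_assoc, Rinv_l by lra. lra. }
  specialize (Hpsi (exist _ _ Hz)). set (w := psi _) in Hpsi.
  change (disk_val (exist _ _ Hz)) with ((d * u - b) / (a - c * u))%C in Hpsi.
  assert (E : (d * (k * u) - b = w * (a - c * (k * u)))%C).
  (* At z = (d u - b) / (a - c u), the factor c z + d equals (a d - b c) / (a - c u), and a z + b is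
     u times that. *)
  { assert (E : ((a * w + b) * (a * d - b * c) = k * u * (c * w + d) * (a * d - b * c))%C).
    { replace ((a * w + b) * (a * d - b * c))%C
        with ((a * w + b) * (c * ((d * u - b) / (a - c * u)) + d) * (a - c * u))%C
        by (field; assumption).
      rewrite Hpsi. field; assumption. }
    assert (E' : (a * w + b = k * u * (c * w + d))%C).
    { replace (a * w + b)%C with ((a * w + b) * (a * d - b * c) / (a * d - b * c))%C
        by (field; assumption).
      rewrite E. field; assumption. }
    replace (d * (k * u) - b)%C with (k * u * (c * w + d) - (a * w + b) + w * (a - c * (k * u)))%C by ring.
    rewrite E'. ring. }
  rewrite E, Cmod_mult. pose proof (Cmod_disk w).
  assert (0 < Cmod (a - c * (k * u))); [| nra].
  apply Cmod_gt_0. intro E0. apply Hdet. rewrite E0 in E.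
  replace (a * d - b * c)%C with ((a - c * (k * u)) * d + c * (d * (k * u) - b))%C by ring.
  rewrite E, E0. ring.
Qed.

Lemma disk_image_mobius (z : C) : (c * z + d)%C <> 0%C ->
  (disk_image ((a * z + b) / (c * z + d)) <-> Cmod z < 1).
Proof.
  intro Hz. unfold disk_image.
  replace (d * ((a * z + b) / (c * z + d)) - b)%C
    with (z * ((a * d - b * c) / (c * z + d)))%C by (field; assumption).
  replace (a - c * ((a * z + b) / (c * z + d)))%C
    with ((a * d - b * c) / (c * z + d))%C by (field; assumption).
  rewrite Cmod_mult.
  assert (0 < Cmod ((a * d - b * c) / (c * z + d))).
  { rewrite Cmod_div by assumption. apply Rdiv_lt_0_compat; apply Cmod_gt_0; assumption. }
  split; intro; [| nra].
  apply Rmult_lt_reg_r with (Cmod ((a * d - b * c) / (c * z + d))); lra.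
Qed.

Lemma linear_two_zeros (p q x y : C) :
  x <> y -> (p * x + q = 0)%C -> (p * y + q = 0)%C -> p = 0%C /\ q = 0%C.
Proof.
  intros Hxy Hx Hy.
  assert (Hp : p = 0%C).
  { replace p with (((p * x + q) - (p * y + q)) / (x - y))%C
      by (field; intro E; apply Hxy; replace x with (x - y + y)%C by ring; rewrite E; ring).
    rewrite Hx, Hy. unfold Cdiv. ring. }
  split; [exact Hp |]. rewrite Hp in Hx. rewrite <- Hx. ring.
Qed.

(** Numerator and denominator each vanish at no more than one of the three points, so one point has
    an image that is neither 0 nor infinity. *)
Lemma mobius_regular_point (x y t : C) : x <> y -> y <> t -> x <> t ->
  exists z, (z = x \/ z = y \/ z = t) /\ (a * z + b)%C <> 0%C /\ (c * z + d)%C <> 0%C.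
Proof.
  intros Hxy Hyt Hxt.
  assert (Ha : forall z w, z <> w -> (a * z + b = 0)%C -> (a * w + b = 0)%C -> False).
  { intros z w Hzw Hz Hw. destruct (linear_two_zeros _ _ _ _ Hzw Hz Hw) as [E1 E2].
    apply Hdet. rewrite E1, E2. ring. }
  assert (Hc : forall z w, z <> w -> (c * z + d = 0)%C -> (c * w + d = 0)%C -> False).
  { intros z w Hzw Hz Hw. destruct (linear_two_zeros _ _ _ _ Hzw Hz Hw) as [E1 E2].
    apply Hdet. rewrite E1, E2. ring. }
  destruct (Ceq_dec (a * x + b) 0), (Ceq_dec (c * x + d) 0),
    (Ceq_dec (a * y + b) 0), (Ceq_dec (c * y + d) 0),
    (Ceq_dec (a * t + b) 0), (Ceq_dec (c * t + d) 0);
    try (exfalso; solve [eauto]);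
    solve [exists x; tauto | exists y; tauto | exists t; tauto].
Qed.

(** On a real line through the origin the region is given by a real quadratic in t. Its outer
    coefficients are explicit because the limits t -> infinity and t -> 0 determine their signs. *)
Lemma disk_image_quadratic (u : C) : exists L : R, forall t : R,
  Cmod (d * (t * u) - b)%C ^ 2 - Cmod (a - c * (t * u))%C ^ 2
  = (Cmod d ^ 2 - Cmod c ^ 2) * Cmod u ^ 2 * t ^ 2 + L * t + (Cmod b ^ 2 - Cmod a ^ 2).
Proof.
  exists (2 * Re (c * u * Cconj a) - 2 * Re (d * u * Cconj b)). intro t.
  rewrite !Cmod2_alt. destruct a, b, c, d, u; simpl. ring.
Qed.

Lemma disk_image_pow (k : R) (u : C) (n : nat) :
  0 < k -> (forall u, disk_image u <-> disk_image (k * u)) ->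
  (disk_image u <-> disk_image ((k ^ n)%R * u)) /\
  (disk_image u <-> disk_image ((/ k ^ n)%R * u)).
Proof.
  intros Hk Hinv.
  assert (H : forall u, disk_image u <-> disk_image ((k ^ n)%R * u)).
  { intro v. induction n as [| n IH].
    - replace ((k ^ 0)%R * v)%C with v by (simpl; ring). tauto.
    - rewrite IH, Hinv. replace ((k ^ S n)%R * v)%C with (k * ((k ^ n)%R * v))%C; [tauto |].
      simpl. rewrite RtoC_mult. ring. }
  split; [apply H |].
  rewrite (H ((/ k ^ n)%R * u)%C), Cmult_assoc, <- RtoC_mult, Rinv_r, Cmult_1_l; [tauto |].
  apply pow_nonzero; lra.
Qed.

(** By invariance the quadratic keeps its sign along t = k^n and t = k^-n. A point inside the region
    makes both outer coefficients nonpositive, a point outside makes them nonnegative. *)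
Lemma disk_image_half_plane (k : R) : 1 < k ->
  (forall u, disk_image u <-> disk_image (k * u)) -> Cmod d = Cmod c /\ Cmod b = Cmod a.
Proof.
  intros Hk Hinv.
  (* The sign [sg] is 1 for the inside point and -1 for the outside point. *)
  assert (Hlim : forall (sg : R) (u : C), u <> 0%C ->
    (forall t : R, (disk_image u <-> disk_image (t * u)) ->
      sg * (Cmod (d * (t * u) - b)%C ^ 2 - Cmod (a - c * (t * u))%C ^ 2) <= 0) ->
    sg * (Cmod d ^ 2 - Cmod c ^ 2) <= 0 /\ sg * (Cmod b ^ 2 - Cmod a ^ 2) <= 0).
  { intros sg u Hu Hsg. destruct (disk_image_quadratic u) as [L HL].
    apply Cmod_gt_0 in Hu. assert (0 < Cmod u ^ 2) by (apply pow_lt, Hu).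
    assert (HP : sg * ((Cmod d ^ 2 - Cmod c ^ 2) * Cmod u ^ 2) <= 0).
    { apply (quadratic_lead_nonpos _ (sg * L) (sg * (Cmod b ^ 2 - Cmod a ^ 2))).
      intro M. destruct (pow_unbounded k M Hk) as [n Hn].
      exists (k ^ n); split; [exact Hn |].
      specialize (Hsg (k ^ n) (proj1 (disk_image_pow k u n ltac:(lra) Hinv))).
      rewrite HL in Hsg. lra. }
    split; [nra |].
    (* Multiplying the value at t = k^-n by k^(2n) reverses the quadratic: the constant term becomes
       the leading one. *)
    apply (quadratic_lead_nonpos _ (sg * L) (sg * ((Cmod d ^ 2 - Cmod c ^ 2) * Cmod u ^ 2))).
    intro M. destruct (pow_unbounded k M Hk) as [n Hn].
    exists (k ^ n); split; [exact Hn |].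
    specialize (Hsg (/ k ^ n) (proj2 (disk_image_pow k u n ltac:(lra) Hinv))).
    assert (0 < k ^ n) by (apply pow_lt; lra).
    rewrite HL in Hsg.
    apply Rmult_le_compat_r with (r := (k ^ n) ^ 2) in Hsg; [| apply pow2_ge_0].
    rewrite Rmult_0_l in Hsg. eapply Rle_trans; [| exact Hsg]. right. field. lra. }
  assert (Hreal : forall x y : R, x <> y -> RtoC x <> RtoC y).
  { intros x y Hxy E. apply Hxy, RtoC_inj, E. }
  assert (Hin : exists u : C, u <> 0%C /\ disk_image u).
  { destruct (mobius_regular_point (RtoC 0) (RtoC (1 / 2)) (RtoC (1 / 3)))
      as (z & Hz & Hz1 & Hz2); [apply Hreal; lra .. |].
    exists ((a * z + b) / (c * z + d))%C. split.
    - intro E. apply Hz1. replace (a * z + b)%C with ((a * z + b) / (c * z + d) * (c * z + d))%C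
        by (field; assumption). rewrite E; ring.
    - apply disk_image_mobius; [assumption |].
      destruct Hz as [-> | [-> | ->]]; rewrite Cmod_R, Rabs_right; lra. }
  assert (Hout : exists u : C, u <> 0%C /\ ~ disk_image u).
  { destruct (mobius_regular_point (RtoC 1) (RtoC 2) (RtoC 3))
      as (z & Hz & Hz1 & Hz2); [apply Hreal; lra .. |].
    exists ((a * z + b) / (c * z + d))%C. split.
    - intro E. apply Hz1. replace (a * z + b)%C with ((a * z + b) / (c * z + d) * (c * z + d))%C
        by (field; assumption). rewrite E; ring.
    - rewrite disk_image_mobius by assumption.
      destruct Hz as [-> | [-> | ->]]; rewrite Cmod_R, Rabs_right; lra. }
  destruct Hin as (u & Hu & Hin), Hout as (v & Hv & Hout).
  destruct (Hlim 1 u Hu) as [P1 R1].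
  { intros t Ht. apply Ht in Hin. unfold disk_image in Hin.
    pose proof (Cmod_ge_0 (d * (t * u) - b)). nra. }
  destruct (Hlim (-1) v Hv) as [P2 R2].
  { intros t Ht. rewrite Ht in Hout. unfold disk_image in Hout. apply Rnot_lt_le in Hout.
    pose proof (Cmod_ge_0 (a - c * (t * v))). nra. }
  pose proof (Cmod_ge_0 a). pose proof (Cmod_ge_0 b).
  pose proof (Cmod_ge_0 c). pose proof (Cmod_ge_0 d).
  split; apply Rsqr_inj; trivial; unfold Rsqr; lra.
Qed.

End NormalForm.

Lemma mobius_semiconjugates (a b c d : C) (k : R) (phi : disk -> disk) :
  (forall z : disk, mobius a b c d (Some (phi z : C)) = dilation k (mobius a b c d (Some (z : C)))) ->
  semiconjugates a b c d k phi.
Proof.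
  intros H z. specialize (H z). unfold mobius, dilation in H.
  destruct (Ceq_dec (c * phi z + d) 0) as [E | E], (Ceq_dec (c * z + d) 0) as [E' | E'];
    cbn [option_map] in H; try discriminate.
  - rewrite E, E'. ring.
  - assert (H' : ((a * phi z + b) / (c * phi z + d) = k * ((a * z + b) / (c * z + d)))%C) by congruence.
    replace (a * phi z + b)%C with ((a * phi z + b) / (c * phi z + d) * (c * phi z + d))%C
      by (field; assumption).
    rewrite H'. field; assumption.
Qed.

(** The fixed points are the pole -d/c and the zero -b/a of s; the half-plane condition puts them on
    the circle. For k < 1 they exchange roles and the multiplier is 1/k. *)
Lemma hyperbolic_automorphism_dilates (phi : disk -> disk) :
  hyperbolic_automorphism phi ->
  exists (al be : C) (mu : R), Cmod al = 1 /\ Cmod be = 1 /\ al <> be /\ 1 < mu /\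
    forall z : disk, dilates al be mu z (phi z).
Proof.
  intros [[g [Hg1 Hg2]] [F [[_ [_ [s [k [[a [b [c [d [Hdet Hs]]]]] [Hk [Hk1 Hconj]]]]]]] HF]]].
  assert (Hphi : semiconjugates a b c d k phi).
  { apply mobius_semiconjugates. intro z. rewrite <- HF, <- !Hs. apply Hconj. }
  assert (HkC : RtoC k <> 0%C) by (intro E; apply RtoC_inj in E; lra).
  (* The inverse of phi scales by 1/k, which turns the inclusion of [disk_image_scale] into
     invariance. *)
  assert (Hg : semiconjugates a b c d (/ k) g).
  { intro z. specialize (Hphi (g z)). rewrite Hg2 in Hphi.
    rewrite RtoC_inv by lra.
    replace (/ k * (a * z + b) * (c * g z + d))%C
      with (/ k * ((a * z + b) * (c * g z + d)))%C by ring.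
    rewrite Hphi. field; assumption. }
  assert (Hinv : forall u, disk_image a b c d u <-> disk_image a b c d (k * u)).
  { intro u; split; intro Hu; [exact (disk_image_scale _ _ _ _ Hdet k phi u Hphi Hu) |].
    apply (disk_image_scale _ _ _ _ Hdet _ _ _ Hg) in Hu.
    replace ((/ k)%R * (k * u))%C with u in Hu; [exact Hu |].
    rewrite RtoC_inv by lra. field; assumption. }
  assert (Hmod : Cmod d = Cmod c /\ Cmod b = Cmod a).
  { destruct (Rlt_le_dec 1 k) as [H1 | H1].
    - apply (disk_image_half_plane _ _ _ _ Hdet k H1 Hinv).
    - apply (disk_image_half_plane _ _ _ _ Hdet (/ k)).
      + rewrite <- Rinv_1. apply Rinv_lt_contravar; lra.
      + intro u. rewrite (Hinv ((/ k)%R * u)%C).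
        replace (k * ((/ k)%R * u))%C with u; [tauto |].
        rewrite RtoC_inv by lra. field; assumption. }
  destruct Hmod as [Hdc Hba].
  assert (Ha : a <> 0%C).
  { intro E. rewrite E, Cmod_0 in Hba. apply Cmod_eq_0 in Hba.
    apply Hdet. rewrite E, Hba. ring. }
  assert (Hc : c <> 0%C).
  { intro E. rewrite E, Cmod_0 in Hdc. apply Cmod_eq_0 in Hdc.
    apply Hdet. rewrite E, Hdc. ring. }
  assert (Hal : Cmod (- d / c)%C = 1).
  { rewrite Cmod_div, Cmod_opp, Hdc by assumption. apply Cmod_gt_0 in Hc. field; lra. }
  assert (Hbe : Cmod (- b / a)%C = 1).
  { rewrite Cmod_div, Cmod_opp, Hba by assumption. apply Cmod_gt_0 in Ha. field; lra. }
  assert (Hne : (- d / c)%C <> (- b / a)%C).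
  { intro E. apply Hdet.
    replace (a * d - b * c)%C with (- (a * c) * (- d / c) + a * c * (- b / a))%C
      by (field; split; assumption).
    rewrite E. ring. }
  assert (Hrel : forall z : disk,
     ((phi z - - b / a) * (- d / c - z) = k * (z - - b / a) * (- d / c - phi z))%C).
  { intro z.
    replace ((phi z - - b / a) * (- d / c - z))%C
      with (- ((a * phi z + b) * (c * z + d)) / (a * c))%C by (field; split; assumption).
    rewrite (Hphi z). field; split; assumption. }
  destruct (Rlt_le_dec 1 k) as [H1 | H1].
  - exists (- d / c)%C, (- b / a)%C, k. repeat split; trivial.
  - exists (- b / a)%C, (- d / c)%C, (/ k). repeat split; trivial.
    + apply not_eq_sym, Hne.
    + rewrite <- Rinv_1. apply Rinv_lt_contravar; lra.
    + intro z. unfold dilates. rewrite RtoC_inv by lra.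
      transitivity (/ k * (k * (z - - b / a) * (- d / c - phi z)))%C;
        [field | rewrite <- Hrel; ring].
      repeat split; assumption.
Qed.

(** * The case nu >= 1/2 *)

Lemma iter_composition_operator (phi : disk -> disk) (n : nat) (f : disk -> C) :
  Nat.iter n (composition_operator phi) f = fun z => f (Nat.iter n phi z).
Proof.
  induction n as [| n IH]; [reflexivity |].
  simpl Nat.iter at 1. rewrite IH. apply functional_extensionality; intro z.
  unfold composition_operator. rewrite <- Nat.iter_succ_r. reflexivity.
Qed.

Lemma dirichlet_open_ball (nu : R) (c : disk -> C) (e : R) :
  dirichlet_space nu c ->
  dirichlet_open nu (fun f => norm_lt nu (fun z => (f z - c z)%C) e).
Proof.
  intro Hc. apply dirichlet_space_norm_lt in Hc as [y Hc]. split.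
  - intros f Hf. apply norm_lt_dirichlet_space with (e + y).
    eapply norm_lt_ext; [| exact (norm_lt_plus _ _ _ _ _ Hf Hc)].
    intro z; simpl; ring.
  - intros f Hf. apply norm_lt_is_norm in Hf as (r & Hr & Hre).
    (* Half of the gap e - r suffices: the other half makes the bound (e + r) / 2 on f - c
       strict. *)
    exists ((e - r) / 2). split; [lra |]. intros g s _ Hs Hse.
    apply norm_lt_le with ((e - r) / 2 + (e + r) / 2); [lra |].
    apply norm_lt_minus_trans with f; apply norm_lt_is_norm; eexists; split; eauto; lra.
Qed.

Lemma disk_0_proof : Cmod 0 < 1.
Proof. rewrite Cmod_0; lra. Qed.

Definition disk_0 : disk := exist _ (RtoC 0) disk_0_proof.

(** Used with X, Y the moduli of [den] at h and 0, W the distance of the two images, and E the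
    defect 1 - |image|^2 at either point: the difference quotient W / h is at most E / (1 - h). *)
Lemma lipschitz_quotient (h k X Y W E : R) :
  0 < h < 1 -> 0 < k -> 0 < X -> 0 < Y ->
  (1 - h) * Y <= X <= (1 + h) * Y -> W * X * Y = k * h ->
  (X ^ 2 * E = k * (1 - h ^ 2) \/ Y ^ 2 * E = k) ->
  W * (1 - h) <= h * E.
Proof.
  intros Hh Hk HX HY HXY HW [HE | HE].
  - apply Rmult_le_reg_r with (X ^ 2 * Y); [apply Rmult_lt_0_compat; [apply pow_lt |]; assumption |].
    replace (W * (1 - h) * (X ^ 2 * Y)) with (k * h * (1 - h) * X) by (rewrite <- HW; ring).
    replace (h * E * (X ^ 2 * Y)) with (k * h * (1 - h) * ((1 + h) * Y))
      by (replace (h * E * (X ^ 2 * Y)) with (h * Y * (X ^ 2 * E)) by ring; rewrite HE; ring).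
    apply Rmult_le_compat_l; [| apply HXY].
    apply Rmult_le_pos; [apply Rmult_le_pos |]; lra.
  - apply Rmult_le_reg_r with (X * Y ^ 2); [apply Rmult_lt_0_compat; [| apply pow_lt]; assumption |].
    replace (W * (1 - h) * (X * Y ^ 2)) with (k * h * ((1 - h) * Y)) by (rewrite <- HW; ring).
    replace (h * E * (X * Y ^ 2)) with (k * h * X)
      by (replace (h * E * (X * Y ^ 2)) with (h * X * (Y ^ 2 * E)) by ring; rewrite HE; ring).
    apply Rmult_le_compat_l; [| apply HXY].
    apply Rmult_le_pos; lra.
Qed.

Lemma not_recurrent (nu : R) (al be : C) (mu : R) (phi : disk -> disk) :
  1 / 2 <= nu -> Cmod al = 1 -> Cmod be = 1 -> al <> be -> 1 < mu ->
  (forall z : disk, dilates al be mu z (phi z)) ->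
  ~ recurrent nu (composition_operator phi).
Proof.
  intros Hnu Hal Hbe Hne Hmu Hphi Hrec.
  set (d := (mu - 1) / (mu + 1)).
  assert (Hd : 0 < d < 1).
  { unfold d; split; [apply Rdiv_lt_0_compat; lra |].
    apply Rmult_lt_reg_r with (mu + 1); [lra |].
    unfold Rdiv; rewrite Rmult_assoc, Rinv_l by lra; lra. }
  (* One number serves as radius of the ball and as the point h, so no limit is taken. The end of
     the proof gives d^2 <= 3 e, which fails for this value. *)
  set (e := d ^ 2 / 4). assert (He : 0 < e < 1) by (unfold e; nra).
  destruct (Hrec (fun f => norm_lt nu (fun z => (f z - z)%C) e))
    as (n & Hn & f & Hf & Hg).
  { apply dirichlet_open_ball. destruct (norm_lt_id nu) as [y Hy].
    exact (norm_lt_dirichlet_space _ _ _ Hy). }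
  { exists (fun z => z). eapply norm_lt_ext; [| apply (norm_lt_const nu 0 e)].
    - intro z; simpl; ring.
    - rewrite Cmod_0; lra. }
  rewrite iter_composition_operator in Hg.
  assert (Hh0 : Cmod (RtoC e) < 1) by (rewrite Cmod_R, Rabs_right; lra).
  set (u := exist _ (RtoC e) Hh0 : disk).
  assert (Hu : Cmod u = e) by (simpl; rewrite Cmod_R, Rabs_right; lra).
  set (v := disk_0). assert (Hv : Cmod v = 0) by apply Cmod_0.
  set (m := mu ^ n).
  assert (Hm : mu <= m).
  (* Here n > 0 is essential: it keeps phi^n 0 away from 0 by the distance d, uniformly in n. *)
  { unfold m. destruct n as [| n]; [lia |]. simpl.
    pose proof (pow_R1_Rle mu n ltac:(lra)). nra. }
  assert (Hm1 : 1 < m) by lra.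
  pose proof (dilates_iter al be mu phi Hal Hphi n u) as Du.
  pose proof (dilates_iter al be mu phi Hal Hphi n v) as Dv. fold m in Du, Dv.
  set (u' := Nat.iter n phi u) in *. set (v' := Nat.iter n phi v) in *.
  set (X := Cmod (den al be m u)). set (Y := Cmod (den al be m 0)).
  set (k := m * Cmod (al - be)%C ^ 2).
  assert (Hk : 0 < k).
  { apply Rmult_lt_0_compat; [lra |]. apply pow_lt, Cmod_gt_0. intro E.
    apply Hne. replace al with (al - be + be)%C by ring. rewrite E; ring. }
  assert (HX : 0 < X) by (apply den_pos; auto; apply Cmod_disk).
  assert (HY : 0 < Y) by (apply den_pos; auto; rewrite Cmod_0; lra).
  assert (HXY : (1 - e) * Y <= X <= (1 + e) * Y).
  { pose proof (den_bounds al be m Hal Hbe Hm1 u) as Hb. rewrite Hu in Hb.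
    unfold X, Y; lra. }
  assert (HW : Cmod (u' - v')%C * X * Y = k * e).
  { unfold k, X, Y. rewrite <- Hu.
    replace (Cmod u) with (Cmod (u - v)%C) by (f_equal; simpl; ring).
    apply dilates_minus; auto using Cmod_disk. }
  assert (HEu : X ^ 2 * (1 - Cmod u' ^ 2) = k * (1 - e ^ 2)).
  { rewrite <- Hu. apply dilates_pick; assumption. }
  assert (HEv : Y ^ 2 * (1 - Cmod v' ^ 2) = k).
  { transitivity (k * (1 - Cmod v ^ 2)); [apply dilates_pick; assumption |].
    rewrite Hv; ring. }
  pose proof (lipschitz_quotient e k X Y _ _ He Hk HX HY HXY HW (or_introl HEu)) as Q1.
  pose proof (lipschitz_quotient e k X Y _ _ He Hk HX HY HXY HW (or_intror HEv)) as Q2.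
  set (W := Cmod (u' - v')%C) in *.
  (* The Lipschitz estimate needs one radius for both points; the maximum is one of the two moduli,
     so [Q] is [Q1] or [Q2]. *)
  set (rho := Rmax (Cmod u') (Cmod v')).
  assert (Hrho : rho < 1) by (apply Rmax_lub_lt; apply Cmod_disk).
  assert (Hrho0 : 0 <= rho) by (eapply Rle_trans; [apply (Cmod_ge_0 u') | apply Rmax_l]).
  assert (Q : W * (1 - e) <= e * (1 - rho ^ 2)).
  { unfold rho. destruct (Rmax_case (Cmod u') (Cmod v') (fun r => W * (1 - e) <= e * (1 - r ^ 2)) Q1 Q2); lra. }
  assert (Hdv : d <= Cmod v').
  { eapply Rle_trans; [| exact (dilates_0_ge al be m Hal Hbe Hm1 v' Dv)].
    unfold d. apply Rmult_le_reg_r with ((mu + 1) * (m + 1)); [nra |].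
    field_simplify; lra. }
  assert (L1 : Cmod (f u' - u' - (f v' - v'))%C <= W * (e / (1 - rho ^ 2))).
  { apply (norm_lt_lipschitz nu (fun z => (f z - z)%C) e rho u' v'); auto.
    - apply Rmax_l. - apply Rmax_r. }
  assert (L2 : Cmod (f u' - u - (f v' - v))%C <= Cmod (u - v)%C * (e / (1 - e ^ 2))).
  { apply (norm_lt_lipschitz nu (fun z => (f (Nat.iter n phi z) - z)%C) e e u v); auto; lra. }
  replace (Cmod (u - v)%C) with e in L2 by (rewrite <- Hu; f_equal; simpl; ring).
  assert (T : e <= W + Cmod (f u' - u' - (f v' - v'))%C + Cmod (f u' - u - (f v' - v))%C).
  { rewrite <- Hu at 1.
    replace (disk_val u) with ((u' - v') + (f u' - u' - (f v' - v')) + - (f u' - u - (f v' - v)))%C at 1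
      by (simpl; ring).
    eapply Rle_trans; [apply Cmod_triangle |]. rewrite Cmod_opp.
    apply Rplus_le_compat_r, Cmod_triangle. }
  assert (Hr2 : 0 < 1 - rho ^ 2) by nra.
  assert (B1 : W * (e / (1 - rho ^ 2)) * (1 - e) <= e * e).
  { replace (W * (e / (1 - rho ^ 2)) * (1 - e)) with (W * (1 - e) * (e / (1 - rho ^ 2))) by ring.
    replace (e * e) with (e * (1 - rho ^ 2) * (e / (1 - rho ^ 2))) by (field; lra).
    apply Rmult_le_compat_r; [apply Rlt_le, Rdiv_lt_0_compat; lra | exact Q]. }
  assert (B2 : e * (e / (1 - e ^ 2)) * (1 - e) <= e * e).
  { replace (e * (e / (1 - e ^ 2)) * (1 - e)) with (e * e * / (1 + e)) by (field; nra).
    rewrite <- (Rmult_1_r (e * e)) at 2. apply Rmult_le_compat_l; [nra |].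
    rewrite <- Rinv_1. apply Rinv_le_contravar; lra. }
  assert (B3 : W * (1 - e) <= e * (1 - d ^ 2)).
  { eapply Rle_trans; [exact Q2 |]. apply Rmult_le_compat_l; [lra |]. nra. }
  (* The triangle inequality [T] multiplied by 1 - e, its three terms being bounded by [B3], [B1]
     and [B2]. *)
  assert (Hfin : e * (1 - e) <= e * (1 - d ^ 2) + e * e + e * e).
  { apply Rle_trans with ((W + W * (e / (1 - rho ^ 2)) + e * (e / (1 - e ^ 2))) * (1 - e)).
    - apply Rmult_le_compat_r; lra.
    - lra. }
  assert (1 - e <= 1 - d ^ 2 + e + e) by (apply Rmult_le_reg_l with e; lra).
  unfold e in *. nra.
Qed.

(** * The case nu < 1/2 *)

(** This is where nu < 1/2 enters: the weight is o(k + 1). The threshold X solves X^(2 nu - 1) = e;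
    below it the weight is at most k + 1 <= X. *)
Lemma weight_le_linear (nu e : R) : nu < 1 / 2 -> 0 < e ->
  exists K, 0 < K /\ forall k, weight nu k <= e * (INR k + 1) + K.
Proof.
  intros Hnu He. set (X := Rpower e (/ (2 * nu - 1))).
  assert (HX : 0 < X) by apply exp_pos.
  exists X; split; [exact HX |]. intro k. unfold weight.
  pose proof (pos_INR k). set (x := INR k + 1). assert (Hx : 1 <= x) by (unfold x; lra).
  destruct (Rle_lt_dec x X) as [HxX | HxX].
  - apply Rle_trans with (Rpower x 1); [apply Rle_Rpower; lra |].
    rewrite Rpower_1 by lra. nra.
  - replace (2 * nu) with ((2 * nu - 1) + 1) by ring.
    rewrite Rpower_plus, Rpower_1 by lra.
    assert (Rpower x (2 * nu - 1) <= e); [| nra].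
    replace e with (Rpower X (2 * nu - 1))
      by (unfold X; rewrite Rpower_mult, Rinv_l, Rpower_1; lra).
    replace (2 * nu - 1) with (- (1 - 2 * nu)) by ring. rewrite 2!Rpower_Ropp.
    apply Rinv_le_contravar; [apply exp_pos |]. apply Rle_Rpower_l; lra.
Qed.

Lemma sum_f_R0_geom_le (x : R) (N : nat) : 0 <= x < 1 -> sum_f_R0 (fun k => x ^ k) N <= / (1 - x).
Proof.
  intro Hx. rewrite tech3 by lra. rewrite <- (Rmult_1_l (/ (1 - x))).
  apply Rmult_le_compat_r; [apply Rlt_le, Rinv_0_lt_compat; lra |].
  pose proof (pow_le x (S N) (proj1 Hx)). lra.
Qed.

Lemma sum_f_R0_succ_geom_le (x : R) (N : nat) :
  0 <= x < 1 -> sum_f_R0 (fun k => (INR k + 1) * x ^ k) N <= / (1 - x) ^ 2.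
Proof.
  intro Hx. apply Rle_trans with (2 := sum_f_R0_deriv_geom x (S N) Hx).
  rewrite (decomp_sum _ (S N)) by lia. simpl Nat.pred.
  replace (INR 0 * _) with 0 by (simpl; ring). rewrite Rplus_0_l. right; apply sum_eq; intros k _. rewrite S_INR. reflexivity.
Qed.

(** * Norms of functions with a simple pole *)

Definition resolvent (w : C) (z : disk) : C := (/ (1 - w * z))%C.

Lemma resolvent_den_neq0 (w : C) (z : C) : Cmod w < 1 -> Cmod z <= 1 -> (1 - w * z)%C <> 0%C.
Proof.
  intros Hw Hz E. pose proof (Cmod_ge_0 w). pose proof (Cmod_ge_0 z).
  assert (E' : (w * z = 1)%C) by (replace (w * z)%C with (1 - (1 - w * z))%C by ring; rewrite E; ring).
  apply (f_equal Cmod) in E'. rewrite Cmod_mult, Cmod_1 in E'. nra.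
Qed.

Lemma power_expansion_resolvent (w : C) :
  Cmod w < 1 -> power_expansion (resolvent w) (fun k => (w ^ k)%C).
Proof.
  intro Hw. rewrite power_expansion_series. intro z. unfold resolvent.
  pose proof (Cmod_disk z) as Hz.
  assert (H1 : (1 - w * z)%C <> 0%C) by (apply resolvent_den_neq0; lra).
  set (q := (w * z)%C) in *.
  assert (Hq : Cmod q < 1).
  { unfold q. rewrite Cmod_mult. pose proof (Cmod_ge_0 w). pose proof (Cmod_ge_0 z). nra. }
  assert (Hsum : forall n, sum_n (G := C_AbelianMonoid) (fun k => ((z : C) ^ k * w ^ k)%C) n
                           = ((1 - q ^ S n) / (1 - q))%C).
  { induction n as [| n IH].
    - rewrite sum_O. simpl. field. exact H1.
    - rewrite sum_Sn, IH. rewrite <- Cpow_mult_l, (Cmult_comm z w). fold q.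
      change (((1 - q ^ S n) / (1 - q) + q ^ S n)%C = ((1 - q ^ S (S n)) / (1 - q))%C).
      rewrite (Cpow_S q (S n)). field. exact H1. }
  apply (filterlim_locally_ball_norm (U := C_NormedModule)). intros [eps Heps].
  apply Cmod_gt_0 in H1 as H1'.
  destruct (pow_lt_1_zero (Cmod q)) with (y := eps * Cmod (1 - q)) as [N HN].
  { rewrite Rabs_right; [exact Hq | apply Rle_ge, Cmod_ge_0]. }
  { apply Rmult_lt_0_compat; assumption. }
  exists N. intros n Hn. unfold ball_norm.
  change (Cmod (sum_n (G := C_AbelianMonoid) (fun k => ((z : C) ^ k * w ^ k)%C) n - / (1 - q))%C < eps).
  rewrite Hsum.
  replace ((1 - q ^ S n) / (1 - q) - / (1 - q))%C with (- (q ^ S n / (1 - q)))%C by (field; exact H1).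
  rewrite Cmod_opp, Cmod_div, Cmod_pow by exact H1.
  apply Rmult_lt_reg_r with (Cmod (1 - q)); [assumption |].
  unfold Rdiv. rewrite Rmult_assoc, Rinv_l, Rmult_1_r by lra.
  eapply Rle_lt_trans; [apply Rle_abs |]. apply HN. lia.
Qed.

Lemma norm_lt_resolvent (nu e : R) : nu < 1 / 2 -> 0 < e ->
  exists K, 0 < K /\ forall (w : C) (y : R), Cmod w < 1 -> 0 < y ->
    e / (1 - Cmod w ^ 2) ^ 2 + K / (1 - Cmod w ^ 2) < y ^ 2 -> norm_lt nu (resolvent w) y.
Proof.
  intros Hnu He. destruct (weight_le_linear nu e Hnu He) as (K & HK & HKw).
  exists K; split; [exact HK |]. intros w y Hw Hy Hlt. split; [exact Hy |].
  exists (fun k => (w ^ k)%C), (e / (1 - Cmod w ^ 2) ^ 2 + K / (1 - Cmod w ^ 2)).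
  split; [apply power_expansion_resolvent, Hw | split; [exact Hlt |]].
  intro N. set (x := Cmod w ^ 2).
  assert (Hx : 0 <= x < 1) by (unfold x; pose proof (Cmod_ge_0 w); split; nra).
  apply Rle_trans with (sum_f_R0 (fun k => (INR k + 1) * x ^ k * e + x ^ k * K) N).
  - apply sum_Rle; intros k _. rewrite Cmod_pow, <- pow_mult, Nat.mul_comm, pow_mult. fold x.
    specialize (HKw k). pose proof (pow_le x k (proj1 Hx)). nra.
  - rewrite plus_sum, <- 2!scal_sum.
    apply Rplus_le_compat; apply Rmult_le_compat_l; try lra.
    + apply sum_f_R0_succ_geom_le, Hx.
    + apply sum_f_R0_geom_le, Hx.
Qed.

(** A pole at distance of order at least 1/m from the circle gives the resolvent norm o(m), which
    coefficients O(1/m) turn into o(1). *)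
Lemma norm_lt_pole_family (nu B k e : R) : nu < 1 / 2 -> 0 < B -> 0 < k -> 0 < e ->
  exists M, 0 < M /\ forall (m : R) (c0 c1 w : C), M <= m -> Cmod w < 1 ->
    Cmod c0 <= B / m -> Cmod c1 <= B / m -> k / m <= 1 - Cmod w ^ 2 ->
    norm_lt nu (fun z => (c0 + z * (c1 * resolvent w z))%C) e.
Proof.
  intros Hnu HB Hk He. set (T := Rpower 2 (Rabs nu)). assert (HT : 0 < T) by apply exp_pos.
  (* Chosen so that a resolvent norm below eta m, times the coefficient B / m and the cost T of
     multiplying by z, leaves e / 2. *)
  set (eta := e / (2 * T * B)).
  assert (Heta : 0 < eta) by (apply Rdiv_lt_0_compat; [| apply Rmult_lt_0_compat]; lra).
  assert (Heta2 : 0 < eta ^ 2) by (apply pow_lt, Heta).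
  destruct (norm_lt_resolvent nu (k ^ 2 * (eta ^ 2 / 2)) Hnu) as (K & HK & HKr).
  { apply Rmult_lt_0_compat; [apply pow_lt, Hk | lra]. }
  assert (HM : 0 <= 2 * K / (k * eta ^ 2)) by (apply Rdiv_le_0_compat; [lra | apply Rmult_lt_0_compat; lra]).
  assert (HM' : 0 < 2 * B / e) by (apply Rdiv_lt_0_compat; lra).
  (* The second summand makes the constant term less than e / 2, the third makes K m / k less than
     (eta m)^2 / 2. *)
  exists (1 + 2 * B / e + 2 * K / (k * eta ^ 2)). split; [lra |].
  intros m c0 c1 w Hm Hw Hc0 Hc1 Hmw.
  assert (Hm0 : 0 < m) by lra.
  replace e with (e / 2 + T * (e / (2 * T))) by (field; lra).
  apply norm_lt_plus.
  - apply norm_lt_const. eapply Rle_lt_trans; [exact Hc0 |].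
    apply Rmult_lt_reg_r with (m * 2 / e); [apply Rdiv_lt_0_compat; lra |].
    replace (B / m * (m * 2 / e)) with (2 * B / e) by (field; lra).
    replace (e / 2 * (m * 2 / e)) with m by (field; lra). lra.
  - apply norm_lt_shift. apply norm_lt_scal with (eta * m).
    + apply HKr; [exact Hw | apply Rmult_lt_0_compat; lra |].
      assert (Hkm : 0 < k / m) by (apply Rdiv_lt_0_compat; lra).
      assert (Hx : / (1 - Cmod w ^ 2) <= m / k).
      { replace (m / k) with (/ (k / m)) by (field; lra). apply Rinv_le_contravar; lra. }
      assert (Hx0 : 0 < / (1 - Cmod w ^ 2)) by (apply Rinv_0_lt_compat; lra).
      replace (k ^ 2 * (eta ^ 2 / 2) / (1 - Cmod w ^ 2) ^ 2 + K / (1 - Cmod w ^ 2))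
        with (k ^ 2 * (eta ^ 2 / 2) * (/ (1 - Cmod w ^ 2)) ^ 2 + K * / (1 - Cmod w ^ 2)) by (field; lra).
      set (x := / (1 - Cmod w ^ 2)) in *.
      apply Rle_lt_trans with (k ^ 2 * (eta ^ 2 / 2) * (m / k) ^ 2 + K * (m / k)).
      * apply Rplus_le_compat; apply Rmult_le_compat_l; try lra.
        -- apply Rmult_le_pos; [apply pow2_ge_0 | lra].
        -- apply pow_incr; lra.
      * assert (Hmm : 2 * K / (k * eta ^ 2) < m) by lra.
        apply Rmult_lt_compat_r with (r := m * (eta ^ 2 / 2)) in Hmm; [| nra].
        replace (2 * K / (k * eta ^ 2) * (m * (eta ^ 2 / 2))) with (K * (m / k)) in Hmm
          by (field; lra).
        replace (k ^ 2 * (eta ^ 2 / 2) * (m / k) ^ 2) with (m * (m * (eta ^ 2 / 2))) by (field; lra).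
        rewrite Rpow_mult_distr. lra.
    + apply Rdiv_lt_0_compat; lra.
    + apply Rle_trans with (B / m * (eta * m)).
      * apply Rmult_le_compat_r; [nra | exact Hc1].
      * right. unfold eta. field. repeat split; lra.
Qed.

(** With A = 1 - w al and B = 1 - w be, the left side is the composed resolvent minus its value 1 /
    A at [al]. The right side has the shape of [norm_lt_pole_family] with pole parameter P / Q; as Q
    is of order m, both coefficients are O(1/m). *)
Lemma resolvent_dilates_decomposition (A B al be z : C) (m : R) :
  let P := (m * A - B)%C in
  let Q := (m * be * A - al * B)%C in
  A <> 0%C -> Q <> 0%C -> (Q - P * z)%C <> 0%C ->
  (den al be m z / - (Q - P * z) - / A
   = (B - A) * al / (A * Q) + z * (- (B - A) * (m * (be - al)) / (Q * Q) * / (1 - P / Q * z)))%C.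
Proof.
  intros P Q HA HQ HPQ.
  assert (E : (/ (1 - P / Q * z) = Q / (Q - P * z))%C).
  { field. split; assumption. }
  rewrite E.
  transitivity (- ((B - A) * (z - al)) / (A * (Q - P * z)))%C.
  - replace (den al be m z) with ((- (Q - P * z) - (B - A) * (al - z)) / A)%C
      by (unfold den, P, Q; field; assumption).
    field. split; assumption.
  - replace (m * (be - al))%C with ((Q - al * P) / A)%C by (unfold P, Q; field; assumption).
    field. repeat split; assumption.
Qed.

Lemma resolvent_pole_modulus (al be w : C) (m : R) : Cmod al = 1 -> Cmod be = 1 ->
  Cmod (m * be * (1 - w * al) - al * (1 - w * be))%C ^ 2 - Cmod (m * (1 - w * al) - (1 - w * be))%C ^ 2
  = m * Cmod (al - be)%C ^ 2 * (1 - Cmod w ^ 2).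
Proof.
  intros Hal Hbe. apply RtoC_inj.
  rewrite ?RtoC_minus, ?RtoC_mult, ?RtoC_minus, !Cmod2_conj.
  rewrite ?Cminus_conj, ?Cmult_conj, ?Cminus_conj, ?Cmult_conj, ?Cconj_R.
  rewrite (unit_conj al Hal), (unit_conj be Hbe).
  field. split; apply unit_neq0; assumption.
Qed.

(** Decay is uniform over all maps with these fixed points and a large multiplier, so exchanging
    [al] and [be] covers the iterates of the inverse. *)
Definition decays (nu : R) (al be : C) (h : disk -> C) : Prop :=
  forall e, 0 < e -> exists M, 0 < M /\ forall (m : R) (psi : disk -> disk), M <= m ->
    (forall z : disk, dilates al be m z (psi z)) -> norm_lt nu (fun z => h (psi z)) e.

Lemma decays_resolvent (nu : R) (al be w : C) :
  nu < 1 / 2 -> Cmod al = 1 -> Cmod be = 1 -> al <> be -> Cmod w < 1 ->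
  decays nu al be (fun z => (resolvent w z - / (1 - w * al))%C).
Proof.
  intros Hnu Hal Hbe Hne Hw e He.
  set (A := (1 - w * al)%C). set (B := (1 - w * be)%C).
  assert (HA : A <> 0%C) by (apply resolvent_den_neq0; lra).
  assert (HA' : 0 < Cmod A) by (apply Cmod_gt_0, HA).
  pose proof (Cmod_ge_0 B) as HB. pose proof (Cmod_ge_0 (B - A)) as HBA.
  assert (Hd : 0 < Cmod (al - be)%C).
  { apply Cmod_gt_0. intro E. apply Hne. replace al with (al - be + be)%C by ring. rewrite E; ring. }
  assert (Hw2 : 0 < 1 - Cmod w ^ 2) by (pose proof (Cmod_ge_0 w); nra).
  (* This bounds m times each coefficient once |Q| >= m |A| / 2; the 1 keeps it positive when w = 0,
     where A = B. *)
  set (b := 4 * Cmod (B - A)%C * (1 + Cmod (al - be)%C) / Cmod A ^ 2 + 1).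
  assert (HA2 : 0 < Cmod A ^ 2) by (apply pow_lt, HA').
  assert (Hb0 : 0 <= 4 * Cmod (B - A)%C / Cmod A ^ 2) by (apply Rdiv_le_0_compat; lra).
  assert (Hb : b = 4 * Cmod (B - A)%C / Cmod A ^ 2 + 4 * Cmod (B - A)%C / Cmod A ^ 2 * Cmod (al - be)%C + 1)
    by (unfold b; field; lra).
  assert (Hbp : 0 <= 4 * Cmod (B - A)%C / Cmod A ^ 2 * Cmod (al - be)%C) by (apply Rmult_le_pos; lra).
  (* Comes from [resolvent_pole_modulus] divided by |Q|^2, with |Q| <= 2 m |A|. *)
  set (k := Cmod (al - be)%C ^ 2 * (1 - Cmod w ^ 2) / (4 * Cmod A ^ 2)).
  assert (Hk : 0 < k) by (apply Rdiv_lt_0_compat; [apply Rmult_lt_0_compat; [apply pow_lt |] |]; lra).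
  destruct (norm_lt_pole_family nu b k e Hnu ltac:(lra) Hk He) as (M & HM & HMf).
  assert (HBA2 : 0 <= 2 * Cmod B / Cmod A) by (apply Rdiv_le_0_compat; lra).
  exists (M + 2 * Cmod B / Cmod A + 2). split; [lra |].
  intros m psi Hm Hpsi.
  assert (Hm0 : 0 < m) by lra.
  set (P := (m * A - B)%C). set (Q := (m * be * A - al * B)%C).
  assert (HmA : 2 * Cmod B <= m * Cmod A).
  { replace (2 * Cmod B) with (2 * Cmod B / Cmod A * Cmod A) by (field; lra).
    apply Rmult_le_compat_r; lra. }
  assert (HQ1 : m * Cmod A / 2 <= Cmod Q).
  { pose proof (Cmod_triangle Q (al * B)) as T.
    replace (Q + al * B)%C with (m * be * A)%C in T by (unfold Q; ring).
    rewrite !Cmod_mult, Cmod_R, Hal, Hbe, Rabs_right in T by lra. lra. }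
  assert (HQ2 : Cmod Q <= 2 * (m * Cmod A)).
  { pose proof (Cmod_triangle (m * be * A) (- (al * B))) as T.
    replace (m * be * A + - (al * B))%C with Q in T by (unfold Q; ring).
    rewrite Cmod_opp, !Cmod_mult, Cmod_R, Hal, Hbe, Rabs_right in T by lra. lra. }
  assert (HQ0 : 0 < m * Cmod A / 2) by (apply Rdiv_lt_0_compat; [apply Rmult_lt_0_compat |]; lra).
  assert (HQ : Q <> 0%C) by (apply Cmod_gt_0; lra).
  assert (HPQ : Cmod Q ^ 2 - Cmod P ^ 2 = m * Cmod (al - be)%C ^ 2 * (1 - Cmod w ^ 2))
    by (apply resolvent_pole_modulus; assumption).
  assert (HQsq : 0 < Cmod Q ^ 2) by (apply pow_lt; lra).
  assert (Hd2 : 0 < Cmod (al - be)%C ^ 2) by (apply pow_lt, Hd).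
  assert (Hpole : k / m <= 1 - Cmod (P / Q)%C ^ 2).
  { rewrite Cmod_div by assumption.
    replace (1 - (Cmod P / Cmod Q) ^ 2) with ((Cmod Q ^ 2 - Cmod P ^ 2) * / Cmod Q ^ 2) by (field; lra).
    rewrite HPQ.
    apply Rle_trans with (m * Cmod (al - be)%C ^ 2 * (1 - Cmod w ^ 2) * / (2 * (m * Cmod A)) ^ 2).
    - right. unfold k. field. split; lra.
    - apply Rmult_le_compat_l; [repeat apply Rmult_le_pos; lra |].
      apply Rinv_le_contravar; [assumption |]. apply pow_incr; lra. }
  assert (Hpole1 : Cmod (P / Q)%C < 1).
  { assert (0 < k / m) by (apply Rdiv_lt_0_compat; lra).
    pose proof (Cmod_ge_0 (P / Q)). nra. }
  apply norm_lt_ext with (fun z : disk => ((B - A) * al / (A * Q)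
      + z * (- (B - A) * (m * (be - al)) / (Q * Q) * resolvent (P / Q) z))%C).
  { intro z. symmetry.
    assert (Hz : (Q - P * z)%C <> 0%C).
    { replace (Q - P * z)%C with (Q * (1 - P / Q * z))%C by (field; assumption).
      apply Cmult_neq_0; [assumption |]. apply resolvent_den_neq0; [assumption |].
      apply Rlt_le, Cmod_disk. }
    transitivity (den al be m z / - (Q - P * z) - / A)%C;
      [| exact (resolvent_dilates_decomposition A B al be z m HA HQ Hz)].
    unfold resolvent. fold A. f_equal.
    pose proof (dilates_den al be m z (psi z) (Hpsi z)) as E.
    assert (Hdz : den al be m z <> 0%C).
    { apply Cmod_gt_0, den_pos; auto using Cmod_disk; lra. }
    replace (1 - w * psi z)%C with (- (Q - P * z) / den al be m z)%C.
    - field. split; assumption.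
    - replace (w * psi z)%C with (w * (psi z * den al be m z) / den al be m z)%C by (field; assumption).
      rewrite E. unfold P, Q, A, B, den in *. field. assumption. }
  assert (Hc : forall x, 0 <= x <= 4 * Cmod (B - A)%C / Cmod A ^ 2 * (1 + Cmod (al - be)%C) -> x / m <= b / m).
  { intros x Hx. apply Rmult_le_compat_r; [apply Rlt_le, Rinv_0_lt_compat; lra | lra]. }
  apply (HMf m); try assumption; [lra | |].
  - rewrite Cmod_div by (apply Cmult_neq_0; assumption). rewrite 2!Cmod_mult, Hal, Rmult_1_r.
    apply Rle_trans with (2 * Cmod (B - A)%C / Cmod A ^ 2 / m).
    + replace (2 * Cmod (B - A) / Cmod A ^ 2 / m) with (Cmod (B - A)%C * / (Cmod A * (m * Cmod A / 2)))
        by (field; lra).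
      apply Rmult_le_compat_l; [assumption |]. apply Rinv_le_contravar.
      * apply Rmult_lt_0_compat; lra.
      * apply Rmult_le_compat_l; lra.
    + apply Hc. unfold Rdiv in *. split; nra.
  - rewrite Cmod_div by (apply Cmult_neq_0; assumption).
    rewrite !Cmod_mult, Cmod_opp, Cmod_R, (Rabs_right m) by lra.
    replace (Cmod (be - al)) with (Cmod (al - be)) by (rewrite <- Cmod_opp; f_equal; ring).
    apply Rle_trans with (4 * Cmod (B - A)%C / Cmod A ^ 2 * Cmod (al - be)%C / m).
    + replace (4 * Cmod (B - A) / Cmod A ^ 2 * Cmod (al - be) / m)
        with (Cmod (B - A) * (m * Cmod (al - be)) * / (m * Cmod A / 2 * (m * Cmod A / 2)))
        by (field; lra).
      apply Rmult_le_compat_l; [repeat apply Rmult_le_pos; lra |].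
      apply Rinv_le_contravar; [apply Rmult_lt_0_compat; lra |].
      apply Rmult_le_compat; lra.
    + apply Hc. lra.
Qed.

Lemma decays_plus (nu : R) (al be : C) (g h : disk -> C) :
  decays nu al be g -> decays nu al be h -> decays nu al be (fun z => (g z + h z)%C).
Proof.
  intros Hg Hh e He.
  destruct (Hg (e / 2)) as (M & HM & HMg); [lra |].
  destruct (Hh (e / 2)) as (M' & HM' & HMh); [lra |].
  exists (M + M'); split; [lra |]. intros m psi Hm Hpsi.
  replace e with (e / 2 + e / 2) by field.
  apply (norm_lt_plus nu (fun z => g (psi z)) (fun z => h (psi z)));
    [apply HMg with m | apply HMh with m]; trivial; lra.
Qed.

Lemma scale_below (c : C) (e : R) : 0 < e -> exists x, 0 < x /\ Cmod c * x <= e.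
Proof.
  intro He. pose proof (Cmod_ge_0 c). exists (e / (Cmod c + 1)). split.
  - apply Rdiv_lt_0_compat; lra.
  - apply Rmult_le_reg_r with (Cmod c + 1); [lra |].
    replace (Cmod c * (e / (Cmod c + 1)) * (Cmod c + 1)) with (Cmod c * e) by (field; lra). nra.
Qed.

Lemma decays_scal (nu : R) (al be c : C) (h : disk -> C) :
  decays nu al be h -> decays nu al be (fun z => (c * h z)%C).
Proof.
  intros Hh e He. destruct (scale_below c e He) as (x & Hx & Hcx).
  destruct (Hh x Hx) as (M & HM & HMh). exists M; split; [exact HM |]. intros m psi Hm Hpsi.
  apply norm_lt_scal with x; [apply HMh with m | |]; trivial.
Qed.

(** * Density of the decaying functions *)

Definition decay_closure (nu : R) (al be : C) (f : disk -> C) : Prop :=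
  forall e, 0 < e -> exists h, norm_lt nu (fun z => (f z - h z)%C) e /\ decays nu al be h.

Section Density.
Variables (nu : R) (al be : C).
Hypotheses (Hnu : nu < 1 / 2) (Hal : Cmod al = 1) (Hbe : Cmod be = 1) (Hne : al <> be).

Lemma decay_closure_decays (h : disk -> C) : decays nu al be h -> decay_closure nu al be h.
Proof.
  intros Hh e He. exists h. split; [apply norm_lt_0; [exact He | intro; ring] | exact Hh].
Qed.

Lemma decay_closure_plus (f g : disk -> C) :
  decay_closure nu al be f -> decay_closure nu al be g ->
  decay_closure nu al be (fun z => (f z + g z)%C).
Proof.
  intros Hf Hg e He.
  destruct (Hf (e / 2)) as (h & Hh & Dh); [lra |].
  destruct (Hg (e / 2)) as (h' & Hh' & Dh'); [lra |].
  exists (fun z => (h z + h' z)%C). split; [| apply decays_plus; assumption].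
  replace e with (e / 2 + e / 2) by field.
  eapply norm_lt_ext; [| exact (norm_lt_plus _ _ _ _ _ Hh Hh')]. intro z; simpl; ring.
Qed.

Lemma decay_closure_scal (c : C) (f : disk -> C) :
  decay_closure nu al be f -> decay_closure nu al be (fun z => (c * f z)%C).
Proof.
  intros Hf e He. destruct (scale_below c e He) as (x & Hx & Hcx).
  destruct (Hf x Hx) as (h & Hh & Dh).
  exists (fun z => (c * h z)%C). split; [| apply decays_scal; assumption].
  eapply norm_lt_ext; [| exact (norm_lt_scal nu c _ x e Hh He Hcx)]. intro z; simpl; ring.
Qed.

Lemma decay_closure_ext (f g : disk -> C) : (forall z, f z = g z) ->
  decay_closure nu al be f -> decay_closure nu al be g.
Proof. intros E H. replace g with f; [exact H | apply functional_extensionality, E]. Qed.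

Lemma decay_closure_limit (f : disk -> C) :
  (forall e, 0 < e -> exists g, norm_lt nu (fun z => (f z - g z)%C) e /\ decay_closure nu al be g) ->
  decay_closure nu al be f.
Proof.
  intros H e He. destruct (H (e / 2)) as (g & Hg & Wg); [lra |].
  destruct (Wg (e / 2)) as (h & Hh & Dh); [lra |].
  exists h. split; [| exact Dh].
  replace e with (e / 2 + e / 2) by field. apply norm_lt_minus_trans with g; assumption.
Qed.

(** [1 - (1 - r) / (1 - r z / al)] vanishes at [al] and tends to [1] as [r]
    tends to [1]: evaluation at [al] is not continuous because [nu <= 1 / 2]. *)
Lemma decay_closure_one : decay_closure nu al be (fun _ => 1%C).
Proof.
  intros e He.
  destruct (norm_lt_pole_family nu 1 1 e Hnu) as (M & HM & HMf); try lra.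
  set (m := M + 2). set (r := 1 - / m).
  assert (Hm : 0 < m) by (unfold m; lra).
  assert (Hm1 : 0 < / m <= / 2).
  { split; [apply Rinv_0_lt_compat, Hm |]. apply Rinv_le_contravar; unfold m; lra. }
  assert (Hal0 : al <> 0%C) by (apply unit_neq0; assumption).
  set (w := (RtoC r / al)%C).
  assert (Hw : Cmod w = r).
  { unfold w. rewrite Cmod_div, Hal, Cmod_R, Rabs_right by (try assumption; unfold r; lra). field. }
  assert (Hwal : (1 - w * al)%C = RtoC (/ m)).
  { unfold w. replace (RtoC r / al * al)%C with (RtoC r) by (field; assumption).
    unfold r. rewrite RtoC_minus. ring. }
  exists (fun z => (- RtoC (/ m) * (resolvent w z - / (1 - w * al)))%C). split.
  (* The difference is 1/m times the resolvent, expanded by 1 / (1 - w z) = 1 + w z / (1 - w z). *)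
  - apply norm_lt_ext with (fun z : disk => (RtoC (/ m) + z * (RtoC (/ m) * w * resolvent w z))%C).
    + intro z. rewrite Hwal.
      assert (RtoC (/ m) <> 0%C) by (intro E; apply RtoC_inj in E; lra).
      unfold resolvent. field. split; [assumption |].
      apply resolvent_den_neq0; [unfold r in *; lra | apply Rlt_le, Cmod_disk].
    + apply (HMf m); unfold m, Rdiv; try lra; fold m.
      * rewrite Hw; unfold r; lra.
      * rewrite Cmod_R, Rabs_right; lra.
      * rewrite Cmod_mult, Hw, Cmod_R, Rabs_right by lra. unfold r. nra.
      * rewrite Hw. unfold r. nra.
  - apply decays_scal, decays_resolvent; trivial. rewrite Hw. unfold r; lra.
Qed.

(** Uniformity in w near 0 is what the limit w -> 0 below requires. *)
Lemma norm_lt_pow_resolvent (j : nat) : exists y, 0 < y /\ forall w, Cmod w <= 1 / 2 ->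
  norm_lt nu (fun z => ((z : C) ^ j * resolvent w z)%C) y.
Proof.
  induction j as [| j (y & Hy & IH)].
  - destruct (norm_lt_resolvent nu 1 Hnu ltac:(lra)) as (K & HK & HKr).
    exists (K + 3). split; [lra |]. intros w Hw.
    eapply norm_lt_ext; [| apply (HKr w (K + 3))]; try lra.
    + intro z; simpl; ring.
    + pose proof (Cmod_ge_0 w).
      assert (H1 : / (1 - Cmod w ^ 2) <= / (3 / 4)) by (apply Rinv_le_contravar; nra).
      assert (H0 : 0 < / (1 - Cmod w ^ 2)) by (apply Rinv_0_lt_compat; nra).
      unfold Rdiv. rewrite <- pow_inv. set (x := / (1 - Cmod w ^ 2)) in *.
      replace (/ (3 * / 4)) with (4 / 3) in H1 by field. nra.
  - exists (Rpower 2 (Rabs nu) * y). split; [apply Rmult_lt_0_compat; [apply exp_pos | exact Hy] |].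
    intros w Hw. eapply norm_lt_ext; [| apply norm_lt_shift, (IH w Hw)].
    intro z; simpl; ring.
Qed.

(** Induction through [z^(j+1) / (1 - w z) = (z^j / (1 - w z) - z^j) / w], the
    value [w = 0] being reached by a limit. *)
Lemma decay_closure_pow_resolvent (j : nat) (w : C) : Cmod w < 1 ->
  decay_closure nu al be (fun z => ((z : C) ^ j * resolvent w z)%C).
Proof.
  revert w. induction j as [| j IH]; intros w Hw.
  - eapply decay_closure_ext; [| apply decay_closure_plus;
      [apply decay_closure_decays, (decays_resolvent nu al be w); trivial
      | apply (decay_closure_scal (/ (1 - w * al))), decay_closure_one]].
    intro z; simpl. ring.
  - assert (Hstep : forall v, Cmod v < 1 -> v <> 0%C ->
      decay_closure nu al be (fun z => ((z : C) ^ S j * resolvent v z)%C)).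
    { intros v Hv Hv0.
      eapply decay_closure_ext; [| apply (decay_closure_scal (/ v)), decay_closure_plus;
        [apply (IH v Hv) | apply (decay_closure_scal (- (1))), (IH 0)]].
      - intro z. unfold resolvent. rewrite Cpow_S. field. repeat split.
        + apply resolvent_den_neq0; [assumption | apply Rlt_le, Cmod_disk].
        + assumption.
      - rewrite Cmod_0; lra. }
    destruct (Ceq_dec w 0) as [-> | Hw0]; [| exact (Hstep w Hw Hw0)].
    apply decay_closure_limit. intros e He.
    destruct (norm_lt_pow_resolvent (S (S j))) as (y & Hy & Hyw).
    (* This gives t <= 1/2 and t y <= e. Replacing w = 0 by t changes the function by -t z^(j+2) /
       (1 - t z), hence the exponent in [Hyw]. *)
    set (t := / (2 + y / e)).
    assert (Hye : 0 < y / e) by (apply Rdiv_lt_0_compat; assumption).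
    assert (Ht : 0 < t <= 1 / 2).
    { unfold t. split; [apply Rinv_0_lt_compat; lra |].
      replace (1 / 2) with (/ 2) by field. apply Rinv_le_contravar; lra. }
    assert (Htm : Cmod (RtoC t) = t) by (rewrite Cmod_R, Rabs_right; lra).
    exists (fun z : disk => ((z : C) ^ S j * resolvent t z)%C). split.
    + eapply norm_lt_ext; [| apply (norm_lt_scal nu (- RtoC t) _ y e (Hyw t ltac:(lra)) He)].
      * intro z. unfold resolvent. rewrite !Cpow_S. field.
        apply resolvent_den_neq0; [lra | apply Rlt_le, Cmod_disk].
      * rewrite Cmod_opp, Htm. replace y with (y / e * e) by (field; lra).
        apply Rle_trans with (1 * e); [| lra]. rewrite <- Rmult_assoc.
        apply Rmult_le_compat_r; [lra |].
        apply Rle_trans with (t * (2 + y / e)); [apply Rmult_le_compat_l; lra |].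
        right. unfold t. rewrite Rinv_l; lra.
    + apply Hstep; [lra |]. intro E. apply RtoC_inj in E. lra.
Qed.

Lemma decay_closure_monomial (j : nat) : decay_closure nu al be (fun z => (z : C) ^ j)%C.
Proof.
  eapply decay_closure_ext; [| apply (decay_closure_pow_resolvent j 0)].
  - intro z. unfold resolvent. field.
  - rewrite Cmod_0; lra.
Qed.

Lemma power_expansion_monomial (j : nat) :
  power_expansion (fun z => (z : C) ^ j)%C (fun k => if Nat.eqb k j then 1%C else 0%C).
Proof.
  induction j as [| j IH].
  - pose proof (power_expansion_const 1) as H. rewrite power_expansion_series in *.
    intro z. eapply is_series_ext; [| exact (H z)]. intros [| k]; reflexivity.
  - apply power_expansion_shift in IH. rewrite power_expansion_series in *.
    intro z. eapply is_series_ext; [| exact (IH z)]. intros [| k]; reflexivity.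
Qed.

Definition tail (a : nat -> C) (N k : nat) : C := if Nat.ltb k N then 0%C else a k.

Lemma decay_closure_truncation (f : disk -> C) (a : nat -> C) (N : nat) : power_expansion f a ->
  exists g, decay_closure nu al be g /\ power_expansion (fun z => (f z - g z)%C) (tail a N).
Proof.
  intro Hf. induction N as [| N (g & Wg & Hg)].
  - exists (fun z => (0 * (z : C) ^ 0)%C). split; [apply decay_closure_scal, decay_closure_monomial |].
    eapply power_expansion_ext; [| | exact Hf]; [intro z; simpl; ring | reflexivity].
  - exists (fun z => (g z + a N * (z : C) ^ N)%C). split.
    + apply decay_closure_plus; [exact Wg | apply decay_closure_scal, decay_closure_monomial].
    + eapply power_expansion_ext; [| | exact (power_expansion_plus _ _ _ _ Hg
        (power_expansion_scal (- a N) _ _ (power_expansion_monomial N)))].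
      * intro z; simpl. ring.
      * intro k. unfold tail.
        destruct (Nat.ltb_spec k N), (Nat.ltb_spec k (S N)), (Nat.eqb_spec k N); subst; try lia; ring.
Qed.

Lemma energy_tail (a : nat -> C) (N n : nat) :
  energy nu (tail a (S N)) n = energy nu a n - energy nu a (Nat.min n N).
Proof.
  unfold energy. induction n as [| n IH].
  - unfold tail; simpl. rewrite Cmod_0. ring.
  - rewrite 2!tech5, IH. unfold tail at 1. destruct (Nat.ltb_spec (S n) (S N)).
    + rewrite !Nat.min_l by lia. rewrite tech5, Cmod_0. ring.
    + rewrite !Nat.min_r by lia. ring.
Qed.

Lemma decay_closure_dirichlet_space (f : disk -> C) :
  dirichlet_space nu f -> decay_closure nu al be f.
Proof.
  intros (r & a & s & Ha & Hs & _). apply decay_closure_limit. intros e He.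
  assert (Hle : forall n, energy nu a n <= s).
  { intro n. apply is_series_sum_f_R0_le; [apply energy_term_ge0 | exact Hs]. }
  assert (HN : exists N, s - energy nu a N < e ^ 2).
  { assert (He2 : 0 < e ^ 2) by (apply pow_lt, He).
    destruct (Hs (fun y => s - y < e ^ 2)) as [N HN].
    - exists (mkposreal _ He2). intros y Hy.
      unfold ball in Hy; simpl in Hy. unfold AbsRing_ball, abs, minus, plus, opp in Hy; simpl in Hy.
      apply Rabs_def2 in Hy. simpl. lra.
    - exists N. specialize (HN N (le_n N)). rewrite sum_n_Reals in HN. exact HN. }
  destruct HN as [N HN].
  destruct (decay_closure_truncation f a (S N) Ha) as (g & Wg & Hg).
  exists g. split; [| exact Wg]. split; [exact He |].
  exists (tail a (S N)), (s - energy nu a N). repeat split; trivial.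
  intro n. rewrite energy_tail. destruct (Nat.min_spec n N) as [[_ ->] | [_ ->]].
  - specialize (Hle N). lra.
  - specialize (Hle n). lra.
Qed.

End Density.

(** * Recurrence from forward and backward decay *)

Lemma dilates_inverse (al be : C) (m : R) (z w : C) : dilates al be m z w -> dilates be al m w z.
Proof.
  unfold dilates. intro E.
  replace ((z - al) * (be - w))%C with ((w - be) * (al - z))%C by ring. rewrite E. ring.
Qed.

Lemma iter_cancel (T : Type) (f g : T -> T) (n : nat) (x : T) :
  (forall y, f (g y) = y) -> Nat.iter n f (Nat.iter n g x) = x.
Proof.
  intro H. induction n as [| n IH]; [reflexivity |].
  rewrite Nat.iter_succ_r. simpl. rewrite H. exact IH.
Qed.

(** With [h1] decaying under [T^n], [h2] decaying under [T^-n] and both close to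
    [f], the function [h1 + T^-n h2] and its image under [T^n] are close to [f]. *)
Lemma recurrent_of_dilates (nu : R) (al be : C) (mu : R) (phi : disk -> disk) :
  nu < 1 / 2 -> Cmod al = 1 -> Cmod be = 1 -> al <> be -> 1 < mu -> Bijective phi ->
  (forall z : disk, dilates al be mu z (phi z)) ->
  recurrent nu (composition_operator phi).
Proof.
  intros Hnu Hal Hbe Hne Hmu (g & Hg1 & Hg2) Hphi U [HU Hopen] [f Hf].
  destruct (Hopen f Hf) as (e & He & Hball).
  assert (HinU : forall h, norm_lt nu (fun z => (h z - f z)%C) e -> U h).
  { intros h Hh. pose proof (HU f Hf) as Hsp. apply dirichlet_space_norm_lt in Hsp as [y Hy].
    assert (Hs : dirichlet_space nu h).
    { apply norm_lt_dirichlet_space with (e + y).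
      eapply norm_lt_ext; [| exact (norm_lt_plus _ _ _ _ _ Hh Hy)]. intro z; simpl; ring. }
    apply norm_lt_is_norm in Hh as (r & Hr & Hre). exact (Hball h r Hs Hr Hre). }
  destruct (decay_closure_dirichlet_space nu al be Hnu Hal Hbe Hne f (HU f Hf) (e / 2))
    as (h1 & Hh1 & D1); [lra |].
  destruct (decay_closure_dirichlet_space nu be al Hnu Hbe Hal (not_eq_sym Hne) f (HU f Hf) (e / 2))
    as (h2 & Hh2 & D2); [lra |].
  destruct (D1 (e / 2)) as (M1 & HM1 & D1'); [lra |].
  destruct (D2 (e / 2)) as (M2 & HM2 & D2'); [lra |].
  apply norm_lt_opp in Hh1, Hh2.
  (* The bound exceeds both decay thresholds, and the 1 excludes n = 0. *)
  destruct (pow_unbounded mu (M1 + M2 + 1) Hmu) as [n Hn].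
  assert (Hphin : forall z : disk, dilates al be (mu ^ n) z (Nat.iter n phi z))
    by (apply dilates_iter; assumption).
  assert (Hgn : forall z : disk, dilates be al (mu ^ n) z (Nat.iter n g z)).
  { intro z. apply dilates_inverse. pose proof (Hphin (Nat.iter n g z)) as H.
    rewrite iter_cancel in H by exact Hg2. exact H. }
  exists n. split; [destruct n; [simpl in Hn; lra | lia] |].
  exists (fun z => (h1 z + h2 (Nat.iter n g z))%C). rewrite iter_composition_operator.
  split; apply HinU; replace e with (e / 2 + e / 2) by field.
  - eapply norm_lt_ext; [| exact (norm_lt_plus _ _ _ _ _ Hh1 (D2' (mu ^ n) _ ltac:(lra) Hgn))].
    intro z; simpl; ring.
  - eapply norm_lt_ext; [| exact (norm_lt_plus _ _ _ _ _ Hh2 (D1' (mu ^ n) _ ltac:(lra) Hphin))].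
    intro z; simpl. rewrite iter_cancel by exact Hg1. ring.
Qed.

Theorem theorem2p5 (phi : disk -> disk) (nu : R)
  (hphi : hyperbolic_automorphism phi) :
  recurrent nu (composition_operator phi) <-> nu < 1 / 2.
Proof.
  pose proof (proj1 hphi) as Hbij.
  destruct (hyperbolic_automorphism_dilates phi hphi) as (al & be & mu & Hal & Hbe & Hne & Hmu & Hphi).
  split.
  - intro Hrec. apply Rnot_le_lt. intro Hnu.
    exact (not_recurrent nu al be mu phi Hnu Hal Hbe Hne Hmu Hphi Hrec).
  - intro Hnu. exact (recurrent_of_dilates nu al be mu phi Hnu Hal Hbe Hne Hmu Hbij Hphi).
Qed.
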